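(* Let $(u_h)_h$ be a family of discrete convex mesh functions which is uniformly bounded (there is $M$ independent of $h$ with $|u_h|\le M$ on $\mathcal{N}_h$) and has Monge-Ampère masses uniformly bounded (there is $C$ independent of $h$ with $\omega(1,u_h,\Omega_h)\le C$). Assume that $u_h=g$ on $\partial\Omega_h$ for a convex function $g\in C(\overline\Omega)$. Then there is a sequence $h_k\to0$ such that $\Gamma(u_{h_k})$ and $u_{h_k}$ converge uniformly on compact subsets of $\Omega$ to the same convex function $v\in C(\Omega)$. Moreover $v=g$ on $\partial\Omega$, i.e. $\lim_{x\to\zeta,\,x\in\Omega}v(x)=g(\zeta)$ for every $\zeta\in\partial\Omega$.
   Context: $\Omega\subset\mathbb{R}^d$ is a nonempty bounded convex domain (open) with boundary $\partial\Omega$. For $h>0$: $\mathbb{Z}^d_h=\{mh: m\in\mathbb{Z}^d\}$ and $\Omega_h=\Omega\cap\mathbb{Z}^d_h$; $h$ is always small enough that $\Omega_h\neq\emptyset$. For $x\in\Omega_h$ and $e\in\mathbb{Z}^d$, $h^e_x=\sup\{rh: r\in[0,1],\ x+rhe\in\overline{\Omega}\}$. The set of directions is $V=\mathbb{Z}^d\setminus\{0\}$. $\partial\Omega_h=\{x\in\partial\Omega: x=y+h^e_y e \text{ for some } y\in\Omega_h, e\in V\}$, $\mathcal{N}_h=\Omega_h\cup\partial\Omega_h$. A mesh function is a function $u_h:\mathcal{N}_h\to\mathbb{R}$. For $e\in V$ and $x\in\Omega_h$, $$\Delta_e u_h(x)=\frac{2}{h^e_x+h^{-e}_x}\Big(\frac{u_h(x+h^e_xe)-u_h(x)}{h^e_x}+\frac{u_h(x-h^{-e}_xe)-u_h(x)}{h^{-e}_x}\Big).$$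 $u_h$ is discrete convex if $\Delta_e u_h(x)\ge0$ for all $x\in\Omega_h$ and $e\in V$. For $x\in\Omega_h$, $\partial_h u_h(x)=\{p\in\mathbb{R}^d: u_h(y)\ge u_h(x)+p\cdot(y-x)\ \forall y\in\mathcal{N}_h\}$, and $\omega(1,u_h,\Omega_h)$ is the Lebesgue measure of $\bigcup_{x\in\Omega_h}\partial_h u_h(x)$ (the Monge-Ampère mass of $u_h$). The convex envelope of $u_h$ is $\Gamma(u_h)(x)=\sup\{L(x): L\text{ affine}, L(y)\le u_h(y)\ \forall y\in\mathcal{N}_h\}$, considered on the convex hull $\operatorname{Conv}(\mathcal{N}_h)$, which contains any given compact subset of $\Omega$ for $h$ small. Uniform convergence on compact subsets of $\Omega$: for every compact $K\subset\Omega$, $\sup_K|\Gamma(u_{h_k})-v|\to0$ and $\max_{x\in K\cap\Omega_{h_k}}|u_{h_k}(x)-v(x)|\to0$. *)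

(* Defs.v *)
From HB Require Import structures.
From mathcomp Require Import all_boot all_order all_algebra.
From mathcomp Require Import all_classical all_reals all_analysis.

Set Implicit Arguments.
Unset Strict Implicit.
Unset Printing Implicit Defensive.
Import Order.TTheory GRing.Theory Num.Theory.
Import numFieldNormedType.Exports.

Local Open Scope classical_set_scope.
Local Open Scope ring_scope.

Definition dotv (R : realType) (d : nat) (p x : 'rV[R]_d) : R :=
  \sum_(i < d) p 0 i * x 0 i.

Definition bdry (T : topologicalType) (A : set T) : set T :=
  closure A `\` interior A.

Definition ivec (R : realType) (d : nat) (e : 'rV[int]_d) : 'rV[R]_d :=
  map_mx intr e.

Definition mesh_int (R : realType) (d : nat) (Omega : set 'rV[R]_d) (h : R) :
    set 'rV[R]_d :=
  Omega `&` [set h *: ivec R m | m in [set: 'rV[int]_d]].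

(* h^e_x *)
Definition mesh_step (R : realType) (d : nat) (Omega : set 'rV[R]_d) (h : R)
    (x : 'rV[R]_d) (e : 'rV[int]_d) : R :=
  sup [set r * h | r in
        [set r | 0 <= r <= 1 /\ closure Omega (x + (r * h) *: ivec R e)]].

Definition mesh_bdry (R : realType) (d : nat) (Omega : set 'rV[R]_d) (h : R) :
    set 'rV[R]_d :=
  [set x | bdry Omega x /\
     exists y e, [/\ mesh_int Omega h y, e != 0 &
                     x = y + mesh_step Omega h y e *: ivec R e]].

Definition mesh (R : realType) (d : nat) (Omega : set 'rV[R]_d) (h : R) :
    set 'rV[R]_d :=
  mesh_int Omega h `|` mesh_bdry Omega h.

(* Mesh functions are total functions on 'rV[R]_d of which only the values on
   [mesh Omega h] are ever used: for x in [mesh_int Omega h] the two points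
   x + h^e_x e and x - h^{-e}_x e below belong to [mesh Omega h]. *)
Definition discrete_delta (R : realType) (d : nat) (Omega : set 'rV[R]_d)
    (h : R) (u : 'rV[R]_d -> R) (e : 'rV[int]_d) (x : 'rV[R]_d) : R :=
  let hp := mesh_step Omega h x e in
  let hm := mesh_step Omega h x (- e) in
  2 / (hp + hm) *
    ((u (x + hp *: ivec R e) - u x) / hp + (u (x - hm *: ivec R e) - u x) / hm).

Definition discrete_convex (R : realType) (d : nat) (Omega : set 'rV[R]_d)
    (h : R) (u : 'rV[R]_d -> R) : Prop :=
  forall x e, mesh_int Omega h x -> e != 0 ->
    0 <= discrete_delta Omega h u e x.

Definition discrete_subdiff (R : realType) (d : nat) (Omega : set 'rV[R]_d)
    (h : R) (u : 'rV[R]_d -> R) (x : 'rV[R]_d) : set 'rV[R]_d :=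
  [set p | forall y, mesh Omega h y -> u x + dotv p (y - x) <= u y].

Definition box (R : realType) (d : nat) (ab : 'rV[R]_d * 'rV[R]_d) :
    set 'rV[R]_d :=
  [set x | forall i, ab.1 0 i <= x 0 i <= ab.2 0 i].

Definition box_volume (R : realType) (d : nat) (ab : 'rV[R]_d * 'rV[R]_d) : R :=
  \prod_(i < d) (ab.2 0 i - ab.1 0 i).

(* Lebesgue outer measure on R^d, d >= 1: infimum of the total volume over the
   countable covers by closed boxes (degenerate boxes allowed). It is the
   Lebesgue measure on Lebesgue measurable sets; below it is only applied to a
   union of closed sets [discrete_subdiff Omega h u x] indexed by
   [mesh_int Omega h], which is finite when Omega is bounded. For d = 0 all
   boxes have volume 1 and the value is +oo. *)
Definition lebesgue_vol (R : realType) (d : nat) (A : set 'rV[R]_d) : \bar R :=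
  ereal_inf [set (\sum_(0 <= k <oo) (box_volume (B k))%:E)%E | B in
    [set B : nat -> 'rV[R]_d * 'rV[R]_d |
       (forall k i, (B k).1 0 i <= (B k).2 0 i) /\
       A `<=` \bigcup_k box (B k)]].

Definition monge_ampere_mass (R : realType) (d : nat) (Omega : set 'rV[R]_d)
    (h : R) (u : 'rV[R]_d -> R) : \bar R :=
  lebesgue_vol (\bigcup_(x in mesh_int Omega h) discrete_subdiff Omega h u x).

(* Extended-real valued: the supremum can be +oo at points outside the convex
   hull of the mesh. *)
Definition convex_envelope (R : realType) (d : nat) (Omega : set 'rV[R]_d)
    (h : R) (u : 'rV[R]_d -> R) (x : 'rV[R]_d) : \bar R :=
  ereal_sup [set (dotv pb.1 x + pb.2)%:E | pb in
    [set pb : 'rV[R]_d * R |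
       forall y, mesh Omega h y -> dotv pb.1 y + pb.2 <= u y]].

(* Uniform convergence on the compact subsets of Omega, where the k-th function
   is only looked at on D k. *)
Definition cvg_on_compacts (R : realType) (d : nat) (Omega : set 'rV[R]_d)
    (D : nat -> set 'rV[R]_d) (f : nat -> 'rV[R]_d -> \bar R)
    (v : 'rV[R]_d -> R) : Prop :=
  forall K : set 'rV[R]_d, compact K -> K `<=` Omega ->
  forall eps : R, 0 < eps ->
    \forall k \near \oo, forall x, K x -> D k x ->
      (`| f k x - (v x)%:E | <= eps%:E)%E.

(* Main.v *)
Require Import Defs.
From HB Require Import structures.
From mathcomp Require Import all_boot all_order all_algebra.
From mathcomp Require Import all_classical all_reals all_analysis.
From mathcomp Require Import ring lra zify.

(** Two facts drive the proof.

    Compactness.  Discrete convexity in all integral directions gives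
    [2 u(y) <= u(y + h e) + u(y - h e)] whenever the three points are in the
    domain.  Iterating along [x], [x + w], [x + 2 w], [x + 4 w], ... yields
    [u(x + w) - u(x) <= (u(x + 2^m w) - u(x)) / 2^m] for lattice vectors [w]
    ([discrete_convex_dyadic]), so a uniformly bounded family is equicontinuous on
    compact subsets.  Instead of extracting subsequences diagonally, the limit [v]
    is taken along an ultrafilter of step sizes finer than the right
    neighbourhoods of 0 ([ulimit]); equicontinuity makes the convergence locally
    uniform, and midpoint convexity of [v] is inherited from the mesh.  A sequence
    is obtained at the end by choosing, for each member of an exhaustion by compact
    sets, one step size which is good there.

    For the convex envelope, an affine minorant of [u] at [y] is dominated, in a
    suitable corner of the lattice cell of [y], by a value of [u], so the envelope
    is asymptotically at most [v] ([convex_envelope_near_le]).  Conversely, [v] is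
    a supremum of affine functions, and each affine minorant [L] of [v] satisfies
    [L - eps <= u] on the whole mesh when [h] is small ([affine_le_mesh]): inside,
    the dyadic inequality compares [u(y)] with a value at a point in a fixed
    compact set; on the boundary, [v] is asymptotically at most [g].

    Boundary values.  The bound from above follows from convexity along lattice
    lines through a fixed interior point, which leave the domain close to the given
    boundary point ([discrete_convex_boundary_upper]).  The bound from below is the
    only place where the Monge-Ampere mass enters, through Aleksandrov's estimate
    ([discrete_mass_boundary_lower]).  If [u] were below an affine minorant [L] of
    [g] by [m] at a mesh point close to [zeta], all affine functions with slope in
    [p + A] would touch the graph of [u] from below at an interior mesh point,
    where [p] is the slope of [L] and [A] is the set of slopes whose increments
    from that point are at most [m] over the domain.  Since the domain is almost on
    one side of a hyperplane through the mesh point, [A] contains a parallelepiped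
    that is very long in the direction normal to it, and its volume exceeds the
    mass bound.

    The volume is an outer measure defined by covers with boxes; the lower bound
    for parallelepipeds is proved by counting sample points
    ([lebesgue_vol_ge_slanted_box]). *)

Set Implicit Arguments.
Unset Strict Implicit.
Unset Printing Implicit Defensive.
Import Order.TTheory GRing.Theory Num.Theory.
Import numFieldNormedType.Exports.

Local Open Scope classical_set_scope.
Local Open Scope ring_scope.

(** * Vectors and the topology of the sup norm *)

Section Vectors.
Context {R : realType}.

Lemma normv_le n (x : 'rV[R]_n) (e : R) :
  0 <= e -> (forall i, `|x 0 i| <= e) -> `|x| <= e.
Proof.
move=> e0 xe; rewrite [leLHS]/Num.norm /= mx_normrE.
by apply/bigmax_leP; split => // -[i j] _ /=; rewrite (ord1 i).
Qed.

Lemma coord_le_normv n (x : 'rV[R]_n) i : `|x 0 i| <= `|x|.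
Proof.
rewrite [leRHS]/Num.norm /= mx_normrE.
by apply: (@le_bigmax _ _ _ _ (fun ij => `|x ij.1 ij.2|) (0, i)).
Qed.

Lemma normv_coord n (x : 'rV[R]_n) : `|x| != 0 -> exists i, `|x 0 i| = `|x|.
Proof.
move=> x0; have [[j i] /= xi] := mx_norm_neq0 x0.
by exists i; rewrite (ord1 j) in xi.
Qed.

Lemma dotvDr n (p x y : 'rV[R]_n) : dotv p (x + y) = dotv p x + dotv p y.
Proof. by rewrite -big_split; apply: eq_bigr => i _ /=; rewrite mxE; ring. Qed.

Lemma dotvDl n (p q x : 'rV[R]_n) : dotv (p + q) x = dotv p x + dotv q x.
Proof. by rewrite -big_split; apply: eq_bigr => i _ /=; rewrite mxE; ring. Qed.

Lemma dotvZr n t (p x : 'rV[R]_n) : dotv p (t *: x) = t * dotv p x.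
Proof. by rewrite mulr_sumr; apply: eq_bigr => i _; rewrite mxE; ring. Qed.

Lemma dotvZl n t (p x : 'rV[R]_n) : dotv (t *: p) x = t * dotv p x.
Proof. by rewrite mulr_sumr; apply: eq_bigr => i _; rewrite mxE; ring. Qed.

Lemma dotvNr n (p x : 'rV[R]_n) : dotv p (- x) = - dotv p x.
Proof. by rewrite -scaleN1r dotvZr mulN1r. Qed.

Lemma dotvNl n (p x : 'rV[R]_n) : dotv (- p) x = - dotv p x.
Proof. by rewrite -scaleN1r dotvZl mulN1r. Qed.

Lemma dotvBr n (p x y : 'rV[R]_n) : dotv p (x - y) = dotv p x - dotv p y.
Proof. by rewrite dotvDr dotvNr. Qed.

Lemma dotvC n (p x : 'rV[R]_n) : dotv p x = dotv x p.
Proof. by apply: eq_bigr => i _; rewrite mulrC. Qed.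

Lemma dotv_sqrD n t (u w : 'rV[R]_n) :
  dotv (u + t *: w) (u + t *: w) = dotv u u + t * (2 * dotv u w + t * dotv w w).
Proof. by rewrite !(dotvDr, dotvDl, dotvZr, dotvZl) (dotvC w u); ring. Qed.

Lemma dotv_norm_le n (p x : 'rV[R]_n) : `|dotv p x| <= n%:R * `|p| * `|x|.
Proof.
apply: (le_trans (ler_norm_sum _ _ _)).
apply: (@le_trans _ _ (\sum_(i < n) `|p| * `|x|)).
  by apply: ler_sum => i _; rewrite normrM ler_pM// coord_le_normv.
by rewrite sumr_const card_ord -mulrA mulr_natl.
Qed.

Lemma dotv_self_gt0 n (x : 'rV[R]_n) : x != 0 -> 0 < dotv x x.
Proof.
move=> x0; rewrite lt_def sumr_ge0 ?andbT => [|i _]; last by rewrite -expr2 sqr_ge0.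
apply: contra x0; rewrite psumr_eq0 => [/allP xx0|i _]; last by rewrite -expr2 sqr_ge0.
apply/eqP/rowP => i; rewrite mxE; have := xx0 i (mem_index_enum _).
by rewrite mulf_eq0 orbb => /eqP.
Qed.

Lemma closure_normP (V : normedModType R) (A : set V) x :
  closure A x <-> forall e, 0 < e -> exists2 y, A y & `|y - x| < e.
Proof.
split=> [clA e e0|h B /nbhs_ballP[e /= e0 eB]].
  have [y [Ay xy]] := clA _ (nbhsx_ballx x e e0).
  by exists y => //; move: xy; rewrite -ball_normE /= distrC.
have [y Ay xy] := h e e0; exists y; split=> //; apply: eB.
by rewrite -ball_normE /= distrC.
Qed.

Lemma open_normP (V : normedModType R) (A : set V) x : open A -> A x ->
  exists2 e : R, 0 < e & forall y, `|y - x| < e -> A y.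
Proof.
move=> oA Ax; have /nbhs_ballP[e /= e0 eA] := open_nbhs_nbhs (conj oA Ax).
by exists e => // y xy; apply: eA; rewrite -ball_normE /= distrC.
Qed.

Lemma bounded_setP n (A : set 'rV[R]_n) : bounded_set A ->
  exists2 D : R, 0 < D & forall y, A y -> `|y| <= D.
Proof.
move=> [D [Dreal hD]]; exists (`|D| + 1); first by rewrite ltr_pwDr.
by apply: hD; rewrite ltr_pwDr// ler_norm.
Qed.

Lemma closure_bounded n (A : set 'rV[R]_n) (D : R) :
  (forall y, A y -> `|y| <= D) -> forall y, closure A y -> `|y| <= D.
Proof.
move=> AD y /closure_normP cly; apply/ler_addgt0Pl => e /cly[z Az zy].
rewrite -(subrKC z y) (le_trans (ler_normD _ _))// [leRHS]addrC lerD ?AD//.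
by rewrite distrC ltW.
Qed.

Lemma within_continuous_normP n (A : set 'rV[R]_n) (f : 'rV[R]_n -> R) x e :
  {within A, continuous f} -> A x -> 0 < e ->
  exists2 r, 0 < r & forall y, A y -> `|y - x| < r -> `|f y - f x| < e.
Proof.
move=> /subspace_continuousP fc Ax e0.
have /cvgrPdist_lt/(_ e e0) := fc _ Ax.
rewrite near_withinE => /nbhs_ballP[r /= r0 rf].
exists r => // y Ay yx; rewrite distrC; apply: rf => //.
by rewrite -ball_normE/= distrC.
Qed.

Lemma finite_set_argmin (T : choiceType) (A : set T) (f : T -> R) :
  finite_set A -> A !=set0 -> exists2 x, A x & forall y, A y -> f x <= f y.
Proof.
move=> /finite_seqP[s ->]; elim: s => [[x]//|a [_ _|b s IH _]].
  by exists a => [|y]; rewrite /= inE// => /eqP->.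
have [|x xs minx] := IH; first by exists b; rewrite /= mem_head.
have [fax|/ltW fxa] := lerP (f a) (f x).
  exists a => [|y]; rewrite /= in_cons ?eqxx// => /predU1P[->//|/minx].
  exact: le_trans.
exists x => [|y]; rewrite /= in_cons; first by rewrite xs orbT.
by move=> /predU1P[->//|/minx].
Qed.

End Vectors.

(** * Convex sets, separation and affine minorants *)

Section Convexity.
Context {R : realType}.
Implicit Types (n : nat).

Lemma convex_set_segment n (A : set 'rV[R]_n) x y t : convex_set A ->
  A x -> A y -> 0 <= t <= 1 -> A (x + t *: (y - x)).
Proof.
move=> cA Ax Ay /andP[t0 t1].
have := cA y x (Itv01 t0 t1); rewrite !inE => /(_ Ay Ax).
rewrite /conv/= /unstable.onem scalerBl scale1r scalerBr.
by congr A; rewrite addrC addrAC -!addrA; congr (_ + _); rewrite addrC.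
Qed.

Lemma convex_function_segment n (A : set 'rV[R]_n) f x y t :
  convex_function A f -> A x -> A y -> 0 <= t <= 1 ->
  f (x + t *: (y - x)) <= f x + t * (f y - f x).
Proof.
move=> cf Ax Ay /andP[t0 t1].
have := cf (Itv01 t0 t1) y x; rewrite !inE => /(_ Ay Ax).
rewrite /conv/= /conv/= /unstable.onem /=.
rewrite (_ : t *: y + (1 - t) *: x = x + t *: (y - x)) /=; last first.
  by apply/rowP => i; rewrite !mxE; ring.
move=> /le_trans; apply.
by rewrite le_eqVlt; apply/orP; left; apply/eqP; rewrite /GRing.scale/=; ring.
Qed.

Lemma closure_convex_segment n (A : set 'rV[R]_n) x y t : convex_set A ->
  closure A x -> A y -> 0 <= t <= 1 -> closure A (x + t *: (y - x)).
Proof.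
move=> cA /closure_normP clx Ay t01; apply/closure_normP => e e0.
have [x' Ax' xx'] := clx e e0; exists (x' + t *: (y - x')).
  exact: convex_set_segment.
rewrite (_ : _ - _ = (1 - t) *: (x' - x)); last first.
  by apply/rowP => i; rewrite !mxE; ring.
case/andP: t01 => t0 t1; rewrite normrZ ger0_norm ?subr_ge0//.
by rewrite (le_lt_trans _ xx')// ler_piMl// gerBl.
Qed.

Lemma convex_set_closure n (A : set 'rV[R]_n) : convex_set A ->
  convex_set (closure A).
Proof.
move=> cA x y l; rewrite !inE => /closure_normP clx /closure_normP cly.
apply/closure_normP => e e0; have e20 : 0 < e / 2 by rewrite divr_gt0.
have [x' Ax' xx'] := clx _ e20; have [y' Ay' yy'] := cly _ e20.
have l0 : 0 <= l%:num by []; have l1 : 0 <= 1 - l%:num by rewrite subr_ge0.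
exists (y' + l%:num *: (x' - y')).
  by apply: convex_set_segment => //; rewrite -[_ <= 1]subr_ge0 l0 l1.
rewrite /conv/= /unstable.onem.
rewrite (_ : _ - _ = l%:num *: (x' - x) + (1 - l%:num) *: (y' - y)); last first.
  by apply/rowP => i; rewrite !mxE; ring.
rewrite (le_lt_trans (ler_normD _ _))// !normrZ (ger0_norm l0) (ger0_norm l1).
move: (l%:num : R) l0 l1 => s s0 s1.
have := ltW xx'; have := ltW yy'.
move: `|_| `|_| xx' yy' => b c be ce; nra.
Qed.

(** The separating direction leads from the point of [closure S] that is nearest
    to [z], in the Euclidean distance, to [z] itself. *)
Lemma separation n (S : set 'rV[R]_n) z : convex_set S -> S !=set0 ->
  ~ closure S z ->
  exists p, exists2 e, 0 < e & forall y, S y -> dotv p (y - z) <= - e.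
Proof.
move=> cS [y0 Sy0] nSz.
pose q (y : 'rV[R]_n) : R := dotv (y - z) (y - z).
have qc : continuous q.
  have -> : q = fun y => \sum_i (y 0 i - z 0 i) * (y 0 i - z 0 i).
    by apply/funext => y; apply: eq_bigr => i _; rewrite !mxE.
  apply: continuous_big => [|i _ y]; first exact: add_continuous.
  have zc : {for y, continuous (fun w : 'rV[R]_n => w 0 i - z 0 i)}.
    apply: (@continuousB _ _ _ (fun w : 'rV[R]_n => w 0 i) (fun=> z 0 i)).
      exact: coord_continuous.
    exact: cst_continuous.
  exact: (continuousM zc zc).
pose K := closure S `&` q @^-1` [set r | r <= q y0].
have Kc : compact K.
  apply: bounded_closed_compact; last first.
    apply: closedI; first exact: closed_closure.
    by apply: preimage_closed; [move=> y _; exact: qc|exact: closed_le].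
  exists (`|z| + (1 + q y0)); split; first exact: num_real.
  move=> M ltM y [_ /= qy]; apply/ltW/(le_lt_trans _ ltM).
  rewrite -[in leLHS](subrK z y) addrC (le_trans (ler_normD _ _))// lerD2l.
  have q0 w : 0 <= q w by apply: sumr_ge0 => i _; rewrite -expr2 sqr_ge0.
  apply: normv_le => [|i]; first by rewrite addr_ge0.
  have : ((y - z) 0 i) ^+ 2 <= q y.
    rewrite /q /dotv (bigD1 i)//= -expr2 lerDl sumr_ge0// => j _.
    by rewrite -expr2 sqr_ge0.
  set r := (y - z) 0 i => ri.
  have : `|r| <= 1 + r ^+ 2.
    by rewrite -real_normK ?num_real//; have := normr_ge0 r; nra.
  lra.
have [a aK amin] : exists2 a, a \in K & forall y, y \in K -> q a <= q y.
  apply: compact_EVT_min => //; last exact: continuous_subspaceT.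
  by exists y0; split; [exact: subset_closure|rewrite /= lexx].
move: aK; rewrite inE => -[cla qa].
have {}amin y : closure S y -> q a <= q y.
  move=> cy; have [qy|/ltW qy] := lerP (q y) (q y0).
    by apply: amin; rewrite inE.
  exact: le_trans qa qy.
have az : a - z != 0 by rewrite subr_eq0; apply/eqP => az; apply: nSz; rewrite -az.
exists (z - a); exists (q a); first exact: dotv_self_gt0.
move=> y Sy.
suff h : 0 <= dotv (a - z) (y - a).
  rewrite (_ : y - z = (y - a) + (a - z)); last by rewrite subrKA.
  rewrite dotvDr -(opprB a z) !dotvNl -/(q a); lra.
rewrite leNgt; apply/negP => B0.
(* along the segment from [a] to [y] the squared distance would decrease at
   first order *)
set B := dotv _ _ in B0; pose Q := dotv (y - a) (y - a).
have Q0 : 0 <= Q by apply: sumr_ge0 => i _; rewrite -expr2 sqr_ge0.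
pose t := - B / (Q - B).
have QB : 0 < Q - B by lra.
have tE : t * (Q - B) = - B by rewrite divfK// gt_eqF.
have t0 : 0 < t by rewrite divr_gt0// oppr_gt0.
have t1 : t <= 1 by rewrite ler_pdivrMr//; lra.
have := amin _ (closure_convex_segment cS cla Sy (_ : 0 <= t <= 1)).
rewrite t1 ltW// => /(_ isT).
rewrite {2}/q (_ : a + _ - z = (a - z) + t *: (y - a)); last by rewrite addrAC.
rewrite dotv_sqrD -/(q a) -/B -/Q.
have : t * (2 * B + t * Q) < 0 by rewrite pmulr_rlt0//; nra.
lra.
Qed.

(** The epigraph of [f], a convex set in one more dimension, is separated from
    the point at height [f x - e] below the graph; lower semicontinuity keeps this
    point away from the closure of the epigraph, and the separating hyperplane is
    not vertical because [x] itself is in the domain. *)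
Lemma affine_minorant n (A : set 'rV[R]_n) (f : 'rV[R]_n -> R) x e :
  convex_set A -> convex_function A f -> A x ->
  (forall e, 0 < e ->
    exists2 r, 0 < r & forall y, A y -> `|y - x| < r -> f x - e < f y) ->
  0 < e ->
  exists p : 'rV[R]_n, exists b : R,
    (forall y, A y -> dotv p y + b <= f y) /\ f x - e <= dotv p x + b.
Proof.
move=> cA cf Ax lscf e0; have e20 : 0 < e / 2 by rewrite divr_gt0.
have [r r0 fr] := lscf _ e20; pose c := f x - e.
pose S := [set z : 'rV[R]_(n + 1) | A (lsubmx z) /\ f (lsubmx z) <= (rsubmx z) 0 0].
have cS : convex_set S.
  move=> z w l; rewrite !inE /S /= => -[Az fz] [Aw fw].
  have l01 : 0 <= l%:num <= 1 by rewrite ge0 le1.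
  have E (u v : 'rV[R]_n) : l%:num *: u + (1 - l%:num) *: v = v + l%:num *: (u - v).
    by apply/rowP => i; rewrite !mxE; ring.
  rewrite /conv/= /unstable.onem /=.
  rewrite !linearD !linearZ /= E; split; first exact: convex_set_segment.
  rewrite (le_trans (convex_function_segment cf Aw Az l01))// !mxE.
  move: fz fw; rewrite !mxE /GRing.scale /=; case/andP: l01; nra.
have clS : ~ closure S (row_mx x c%:M).
  move=> /closure_normP /(_ (Num.min r (e / 2))) []; first by rewrite lt_min r0 e20.
  move=> z [Az fz]; rewrite lt_min => /andP[zr ze].
  have /(le_lt_trans (coord_le_normv _ (rshift n 0))) := ze.
  rewrite !mxE (unsplitK (inr _)) !mxE eqxx mulr1n.
  have lz : `|lsubmx z - x| < r.
    rewrite (le_lt_trans _ zr)//; apply: normv_le => // i.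
    by have := coord_le_normv (z - row_mx x c%:M) (lshift 1 i);
      rewrite !mxE (unsplitK (inl _)).
  have := fr _ Az lz; move: fz; rewrite !mxE /c => fz fz2.
  by rewrite ltr_norml => /andP[_]; lra.
have S0 : S !=set0.
  exists (row_mx x (f x)%:M); rewrite /S /= row_mxKl row_mxKr; split => //.
  by rewrite mxE eqxx mulr1n.
have [p [d d0 pd]] := separation cS S0 clS.
pose p1 := lsubmx p; pose s := (rsubmx p) 0 0.
have {}pd y t : A y -> f y <= t -> dotv p1 (y - x) + s * (t - c) <= - d.
  move=> Ay ft; have := pd (row_mx y t%:M).
  rewrite /S /= row_mxKl row_mxKr mxE eqxx mulr1n => /(_ (conj Ay ft)).
  rewrite /dotv big_split_ord /= big_ord1 !mxE.
  rewrite !(unsplitK (inr _)) !mxE eqxx !mulr1n.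
  rewrite (_ : \sum_(i < n) _ = dotv p1 (y - x)) /s ?mxE//.
  by apply: eq_bigr => i _; rewrite !mxE !(unsplitK (inl _)).
have s0 : s < 0.
  have := pd x (f x) Ax (lexx _); rewrite subrr (_ : dotv p1 0 = 0) /c; first nra.
  by rewrite -(scale0r (0 : 'rV_n)) dotvZr mul0r.
have si : 0 < (- s)^-1 by rewrite invr_gt0 oppr_gt0.
exists ((- s)^-1 *: p1), (c - dotv ((- s)^-1 *: p1) x).
split=> [y Ay|]; last by rewrite addrCA subrr addr0.
have := pd y (f y) Ay (lexx _); rewrite !dotvZl dotvBr => h.
set a := dotv p1 y in h *; set b := dotv p1 x in h *.
have ssi : (- s)^-1 * s = -1.
  by rewrite -[s in X in _ * X]opprK mulrN mulVf// oppr_eq0 lt_eqF.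
have : (- s)^-1 * (a - b + s * (f y - c)) <= 0.
  by rewrite pmulr_rle0//; lra.
by rewrite mulrDr mulrA ssi; lra.
Qed.

End Convexity.

(** * The volume of slanted boxes *)

Section SlantedBoxVolume.
Context {R : realType} (d : nat).
Implicit Types (i j : 'I_d) (o nu l t x a b : 'rV[R]_d).

(** The point [o + t i * nu + \sum_(j | j != i) t j * e_j], with [e_j] the unit
    vectors: the box of the parameters [t] is sheared so that its [i]-th edge
    follows [nu]. *)
Definition slant i nu o t : 'rV[R]_d :=
  \row_j (o 0 j + t 0 i * nu 0 j + (if j == i then 0 else t 0 j)).

Definition sample l n (k : {ffun 'I_d -> 'I_n}) : 'rV[R]_d :=
  \row_j (l 0 j * (k j)%:R / n%:R).

Lemma slant_dist i nu o t t' :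
  `|slant i nu o t - slant i nu o t'| <= (`|nu| + 1) * `|t - t'|.
Proof.
apply: normv_le => [|j]; first by rewrite mulr_ge0// addr_ge0.
have ti := coord_le_normv (t - t') i; have tj := coord_le_normv (t - t') j.
have nj := coord_le_normv nu j; rewrite !mxE in ti tj *.
rewrite (_ : _ - _ = (t 0 i - t' 0 i) * nu 0 j +
    if j == i then 0 else t 0 j - t' 0 j); last by case: eqP => _; ring.
apply: (le_trans (ler_normD _ _)); rewrite [leRHS]mulrDl; apply: lerD.
  by rewrite normrM mulrC ler_pM.
by case: ifP => _; rewrite ?normr0 mul1r.
Qed.

Lemma dotv_slant i (nu o t w : 'rV[R]_d) :
  dotv (slant i nu o t - o) w =
    t 0 i * dotv nu w + \sum_j (if j == i then 0 else t 0 j) * w 0 j.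
Proof.
rewrite /dotv mulr_sumr -big_split/=; apply: eq_bigr => j _.
by rewrite !mxE; case: ifP => _; ring.
Qed.

(** The samples are spaced by [l j / n] along the [j]-th side.  Dividing the
    coordinates by this spacing and truncating determines the sample: the
    [i]-th coordinate gives the [i]-th index because [nu 0 i] is a sign, and
    then the shift along [nu] is common to all the other coordinates. *)
Lemma card_samples_in_box i nu o l n a b : (0 < n)%N ->
  `|nu 0 i| = 1 -> (forall j, 0 < l 0 j) -> (forall j, a 0 j <= b 0 j) ->
  #|[set k : {ffun 'I_d -> 'I_n} |
      `[< box (a, b) (slant i nu o (sample l k)) >] ]%SET|%:R
    <= \prod_j (n%:R / l 0 j * (b 0 j - a 0 j) + 1) :> R.
Proof.
move=> n0 nui l0 ab; have n0R : 0 < n%:R :> R by rewrite ltr0n.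
pose c j := Num.truncn (n%:R / l 0 j * (b 0 j - a 0 j)).
pose pos (k : {ffun 'I_d -> 'I_n}) j :=
  n%:R / l 0 j * (slant i nu o (sample l k) 0 j - a 0 j).
pose f (k : {ffun 'I_d -> 'I_n}) : {dffun forall j : 'I_d, 'I_(c j).+1} :=
  [ffun j => inord (Num.truncn (pos k j))].
set D := [set k | _]%SET.
have nl j : 0 < n%:R / l 0 j by rewrite divr_gt0.
have posD k j : k \in D -> 0 <= pos k j <= n%:R / l 0 j * (b 0 j - a 0 j).
  rewrite inE => /asboolP /(_ j) /= /andP[ak kb].
  by rewrite mulr_ge0 ?ler_pM2l ?lerB ?subr_ge0// ltW.
have f_inj : {in D &, injective f}.
  move=> k k' kD k'D /ffunP fkk'.
  have posd j : `|pos k j - pos k' j| < 1.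
    have := fkk' j; rewrite !ffunE => /(congr1 val) /=.
    have /andP[p0 pb] := posD k j kD; have /andP[p0' pb'] := posD k' j k'D.
    rewrite !inordK ?ltnS ?le_truncn// => tE.
    have /andP[t1 t2] := truncn_itv p0; have /andP[t3 t4] := truncn_itv p0'.
    by rewrite -tE -natr1 in t3 t4; rewrite -natr1 in t2; rewrite ltr_norml; lra.
  have nat_eq (m m' : nat) : `|m%:R - m'%:R| < 1 :> R -> m = m'.
    rewrite ltr_distlC => /andP[].
    rewrite ltrBlDr natr1 natr1 !ltr_nat !ltnS => ? ?; apply/eqP.
    by rewrite eqn_leq; apply/andP.
  have nlk j (s s' : 'I_n) :
      n%:R / l 0 j * (l 0 j * s%:R / n%:R - l 0 j * s'%:R / n%:R) = s%:R - s'%:R.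
    by field; rewrite !gt_eqF.
  have ki : k i = k' i.
    apply/val_inj/nat_eq; have := posd i.
    rewrite /pos -mulrBr !mxE eqxx !addr0.
    rewrite (_ : n%:R / l 0 i * _ = (n%:R / l 0 i *
        (l 0 i * (k i)%:R / n%:R - l 0 i * (k' i)%:R / n%:R)) * nu 0 i); last by ring.
    by rewrite nlk normrM nui mulr1.
  apply/ffunP => j; have [->//|ji] := eqVneq j i.
  apply/val_inj/nat_eq; have := posd j.
  rewrite /pos -mulrBr !mxE (negbTE ji) ki.
  rewrite (_ : n%:R / l 0 j * _ = n%:R / l 0 j *
      (l 0 j * (k j)%:R / n%:R - l 0 j * (k' j)%:R / n%:R)); last by ring.
  by rewrite nlk.
apply: (@le_trans _ _ (\prod_j (c j).+1%:R)).
  rewrite -natr_prod ler_nat (leq_trans (leq_card_in _ _ f_inj))//.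
  rewrite card_dep_ffun foldrE big_map big_enum /=.
  by apply: eq_leq; apply: eq_bigr => j _; rewrite card_ord.
apply: ler_prod => j _; rewrite ler0n -natr1 lerD2r /= truncn_le.
by rewrite mulr_ge0 ?subr_ge0// ltW.
Qed.

Lemma prod_le_sum_covering_boxes i nu o l n N (a b : nat -> 'rV[R]_d) :
  (0 < n)%N -> `|nu 0 i| = 1 -> (forall j, 0 < l 0 j) ->
  (forall m j, a m 0 j <= b m 0 j) ->
  (forall t, (forall j, 0 <= t 0 j <= l 0 j) ->
    exists2 m, (m < N)%N & box (a m, b m) (slant i nu o t)) ->
  \prod_j l 0 j <= \sum_(m < N) \prod_j (b m 0 j - a m 0 j + l 0 j / n%:R).
Proof.
move=> n0 nui l0 ab cover; have n0R : 0 < n%:R :> R by rewrite ltr0n.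
pose D (m : 'I_N) := [set k : {ffun 'I_d -> 'I_n} |
      `[< box (a m, b m) (slant i nu o (sample l k)) >] ]%SET.
have : (n ^ d <= \sum_(m < N) #|D m|)%N.
  rewrite -[n in leqLHS]card_ord -[d in leqLHS]card_ord -card_ffun -cardsT.
  rewrite (_ : [set: _]%SET = \bigcup_(m < N) D m)%SET.
    by elim/big_ind2 : _ => [|A c B e Ac Be|//];
      rewrite ?cards0// (leq_trans (leq_card_setU _ _))// leq_add.
  apply/setP => k; rewrite inE; apply/esym/bigcupP.
  have [|m mN bm] := cover (sample l k).
    move=> j; rewrite mxE divr_ge0 ?mulr_ge0 ?(ltW (l0 _))//=.
    by rewrite ler_pdivrMr// ler_pM2l// ler_nat ltnW.
  by exists (Ordinal mN); rewrite // inE; apply/asboolP.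
rewrite -(ler_nat R) natr_sum natrX => nD.
have L0 : 0 < \prod_j (n%:R / l 0 j) :> R.
  by apply: prodr_gt0 => j _; rewrite divr_gt0.
rewrite -(ler_pM2l L0) -big_split/= (eq_bigr (fun=> n%:R)) => [|j _]; last first.
  by rewrite divfK// gt_eqF.
rewrite prodr_const card_ord (le_trans nD)// mulr_sumr; apply: ler_sum => m _.
rewrite (le_trans (card_samples_in_box _ _ _ _ _))// -big_split/=.
rewrite le_eqVlt; apply/orP; left; apply/eqP; apply: eq_bigr => j _.
by field; rewrite !gt_eqF.
Qed.

(** The map [slant i nu o] has determinant [nu 0 i], a sign.  A countable cover
    by boxes is enlarged slightly so that, by compactness, finitely many of the
    boxes suffice; comparing the numbers of samples in the slanted box and in
    these boxes then compares their volumes. *)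
Lemma lebesgue_vol_ge_slanted_box i nu o l (A : set 'rV[R]_d) :
  `|nu 0 i| = 1 -> (forall j, 0 < l 0 j) ->
  (forall t, (forall j, 0 <= t 0 j <= l 0 j) -> A (slant i nu o t)) ->
  ((\prod_j l 0 j)%:E <= lebesgue_vol A)%E.
Proof.
move=> nui l0 lA; apply: le_ereal_inf_tmp => _ [B [Ble AB] <-].
apply/lee_addgt0Pr => e e0.
pose w k j := (B k).2 0 j - (B k).1 0 j.
have w0 k j : 0 <= w k j by rewrite subr_ge0.
(* the sides grow by [2 * eta] when the boxes are enlarged, and by the sample
   spacing, at most another [eta], when samples are counted *)
have /choice[eta etaP] k : exists eta : R, 0 < eta /\
    \prod_j (w k j + 3 * eta) <= box_volume (B k) + e / (2 ^ k.+1)%:R.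
  pose P := \prod_j ((w k j)%:P + 3 *: 'X) : {poly R}.
  have PE (t : R) : P.[t] = \prod_j (w k j + 3 * t).
    by rewrite horner_prod; apply: eq_bigr => j _; rewrite !hornerE.
  have /cvgrPdist_le/(_ (e / (2 ^ k.+1)%:R)) : P.[t] @[t --> 0] --> P.[0].
    exact: continuous_horner.
  rewrite divr_gt0// ?ltr0n ?expn_gt0// => /(_ isT) /nbhs_ballP[r /= r0 rP].
  exists (r / 2); split; first by rewrite divr_gt0.
  have /= := rP (r / 2); rewrite -ball_normE/= sub0r normrN gtr0_norm ?divr_gt0//.
  rewrite ltr_pdivrMr// ltr_pMr// ltr1n => /(_ isT).
  rewrite !PE ler_distlC => /andP[_ /le_trans]; apply.
  rewrite lerD2r; apply: ler_prod => j _.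
  by rewrite mulr0 addr0 w0 lexx.
pose b k (s : R) := \row_j ((B k).2 0 j + s) : 'rV[R]_d.
pose a k (s : R) := \row_j ((B k).1 0 j - s) : 'rV[R]_d.
pose T := [set t : 'rV[R]_d | forall j, t 0 j \in `[0, l 0 j]].
have Tc : compact T.
  apply: (@rV_compact _ _ (fun j => `[0, l 0 j]%classic)) => j.
  exact: segment_compact.
have [N _ NT] : \forall N \near \oo, T `<=` [set t | exists2 m, (m < N)%N &
    box (a m (eta m), b m (eta m)) (slant i nu o t)].
  move/compact_near_coveringP : Tc; apply => t Tt.
  have [m _ Bm] := AB _ (lA t (fun j => Tt j)).
  have [eta0 _] := etaP m.
  exists (ball t (eta m / (`|nu| + 1)), [set N | (m < N)%N]) => /=.
    split; first by apply: nbhsx_ballx; rewrite divr_gt0// ltr_pwDr.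
    by exists m.+1.
  move=> [t' N] [/= tt' mN]; exists m => // j.
  have : `|slant i nu o t - slant i nu o t'| <= eta m.
    rewrite (le_trans (slant_dist _ _ _ _ _))// mulrC -ler_pdivlMr ?ltr_pwDr//.
    by move: tt'; rewrite -ball_normE => /ltW.
  move/(le_trans (coord_le_normv _ j)); have := Bm j => /=.
  move: (slant i nu o t) (slant i nu o t') => y y' /andP[B1 B2].
  by rewrite !mxE ler_distl => /andP[]; lra.
have [n n0 nl] : exists2 n, (0 < n)%N &
    forall m j, (m < N)%N -> l 0 j / n%:R <= eta m.
  pose s := \sum_(m < N) \sum_j l 0 j / eta m.
  exists (Num.truncn s).+1 => // m j mN; have [eta0 _] := etaP m.
  rewrite ler_pdivrMr ?ltr0n// mulrC -ler_pdivrMr//.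
  apply: le_trans (ltW (truncnS_gt s)).
  rewrite /s (bigD1 (Ordinal mN))//= (bigD1 j)//= -addrA lerDl.
  by rewrite addr_ge0// !sumr_ge0// => m' _; rewrite ?sumr_ge0// => *;
    rewrite divr_ge0// ?(ltW (l0 _))// ltW//; have [] := etaP m'.
have := @prod_le_sum_covering_boxes i nu o l n N (fun m => a m (eta m))
   (fun m => b m (eta m)) n0 nui l0.
have -> : (forall m j, a m (eta m) 0 j <= b m (eta m) 0 j) <-> True.
  by split => // _ m j; rewrite !mxE; have := w0 m j; have [] := etaP m; rewrite /w; lra.
move=> /(_ I) le_sum.
have {le_sum} le_sum : \prod_j l 0 j <=
    \sum_(m < N) (box_volume (B m) + e / (2 ^ m.+1)%:R).
  rewrite (le_trans (le_sum _))// => [t tl|].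
    by apply: NT => /= [|j]; rewrite ?leqnn// in_itv/=.
  apply: ler_sum => m _; have [eta0 etam] := etaP m.
  apply: le_trans etam; apply: ler_prod => j _; rewrite !mxE.
  have := nl m j (ltn_ord m); have := w0 m j; rewrite /w.
  have : 0 < l 0 j / n%:R by rewrite divr_gt0 ?ltr0n.
  lra.
have vol0 k : (0 <= (box_volume (B k))%:E)%E.
  by rewrite lee_fin; apply: prodr_ge0 => j _; exact: w0.
apply: le_trans (epsilon_trick xpredT vol0 (ltW e0)).
apply: le_trans (nneseries_lim_ge N _); last first.
  by move=> k _ _; rewrite adde_ge0// lee_fin divr_ge0 ?ltW.
by rewrite big_mkord sumEFin lee_fin.
Qed.

End SlantedBoxVolume.

(** * Convex domains *)

Section ConvexDomain.
Context {R : realType} {n : nat} (Omega : set 'rV[R]_n).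
Context (Omega_open : open Omega) (Omega_convex : convex_set Omega).

(** Replacing [z] by a nearby point of [Omega] is compensated by a small
    displacement of [x], for which there is room around [x]. *)
Lemma closure_segment_interior z x t :
  closure Omega z -> Omega x -> 0 < t <= 1 -> Omega (z + t *: (x - z)).
Proof.
move=> /closure_normP clz Ox /andP[t0 t1].
have [e e0 eO] := open_normP Omega_open Ox.
have [z' Oz' z'z] := clz _ (mulr_gt0 t0 e0).
have Ox' : Omega (x + ((1 - t) / t) *: (z - z')).
  apply: eO; rewrite addrAC subrr add0r normrZ ger0_norm ?divr_ge0 ?subr_ge0 ?(ltW t0)//.
  rewrite mulrAC ltr_pdivrMr// (mulrC e) (le_lt_trans _ z'z)// distrC.
  by rewrite ler_piMl//; lra.
rewrite (_ : _ + _ = z' + t *: (x + ((1 - t) / t) *: (z - z') - z')).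
  by apply: convex_set_segment; rewrite // ltW.
by apply/rowP => i; rewrite !mxE; field; rewrite gt_eqF.
Qed.

(** Otherwise [zeta] would lie strictly between an adherent point of [Omega] and
    the point [x] of [Omega], hence in [Omega]. *)
Lemma outward_not_closure zeta x t : bdry Omega zeta -> Omega x -> 0 < t ->
  ~ closure Omega (zeta + t *: (zeta - x)).
Proof.
move=> [_ nOz] Ox t0 clz; apply: nOz; rewrite ((interior_id _).1 Omega_open).
rewrite (_ : zeta = zeta + t *: (zeta - x) +
    (t / (1 + t)) *: (x - (zeta + t *: (zeta - x)))); last first.
  by apply/rowP => i; rewrite !mxE; field; rewrite gt_eqF//; lra.
apply: closure_segment_interior => //.
by rewrite divr_gt0 ?ler_pdivrMr; lra.
Qed.

End ConvexDomain.

(** * Meshes and discrete convexity *)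

Section Mesh.
Context {R : realType} {d : nat}.
Implicit Types (h : R) (x y : 'rV[R]_d) (e : 'rV[int]_d).

Lemma ivecD e e' : ivec R (e + e') = ivec R e + ivec R e'.
Proof. exact: map_mxD. Qed.

Lemma ivecN e : ivec R (- e) = - ivec R e.
Proof. exact: map_mxN. Qed.

Lemma ivecMn e m : ivec R (e *+ m) = m%:R *: ivec R e.
Proof.
by elim: m => [|m IH]; rewrite ?scale0r ?mulr0n ?mulrS ?ivecD ?IH;
  apply/rowP => j; rewrite !mxE ?mulrS; ring.
Qed.

Definition mesh_round h x : 'rV[R]_d := h *: ivec R (\row_j Num.floor (x 0 j / h)).

Lemma mesh_round_dist h x : 0 < h -> `|mesh_round h x - x| <= h.
Proof.
move=> h0; apply: normv_le => [|j]; first exact: ltW.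
rewrite !mxE; have /andP[] := floor_itv (x 0 j / h).
rewrite intrD1 ler_pdivlMr// ltr_pdivrMr// mulrDl mul1r (mulrC _ h) => f1 f2.
by rewrite ler_norml; lra.
Qed.

Lemma mesh_int_round Omega h x : Omega (mesh_round h x) ->
  mesh_int Omega h (mesh_round h x).
Proof. by move=> Ox; split => //; eexists. Qed.

Lemma mesh_intB Omega h x y : mesh_int Omega h x -> mesh_int Omega h y ->
  exists e, y - x = h *: ivec R e.
Proof.
move=> [_ [e _ <-]] [_ [e' _ <-]]; exists (e' - e).
by rewrite ivecD ivecN scalerDr scalerN.
Qed.

Lemma mesh_intD Omega h x e : mesh_int Omega h x -> Omega (x + h *: ivec R e) ->
  mesh_int Omega h (x + h *: ivec R e).
Proof.
move=> [_ [m _ <-]] Oxe; split => //; exists (m + e) => //.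
by rewrite ivecD scalerDr.
Qed.

Section Step.
Context (Omega : set 'rV[R]_d).
Context (Omega_open : open Omega) (Omega_convex : convex_set Omega).
Context (h : R) (x : 'rV[R]_d) (e : 'rV[int]_d).
Context (h0 : 0 < h) (Ox : Omega x).

Let steps := [set r * h | r in
  [set r | 0 <= r <= 1 /\ closure Omega (x + (r * h) *: ivec R e)]].

Let stepsP s : steps s <-> 0 <= s <= h /\ closure Omega (x + s *: ivec R e).
Proof.
split=> [[r [/andP[r0 r1] clr] <-]|[/andP[s0 sh] cls]].
  by split; rewrite // mulr_ge0 ?(ltW h0)//= ler_piMl// ltW.
by exists (s / h); rewrite /= divfK ?gt_eqF// divr_ge0 ?(ltW h0)//= ler_pdivrMr ?mul1r.
Qed.

Let steps_sup : has_sup steps.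
Proof.
split; last by exists h => s /stepsP[/andP[]].
exists 0; apply/stepsP; rewrite lexx ltW//; split => //.
by rewrite scale0r addr0; exact: subset_closure.
Qed.

Let step_ub s : 0 <= s <= h -> closure Omega (x + s *: ivec R e) ->
  s <= mesh_step Omega h x e.
Proof. by move=> sh cls; apply: sup_upper_bound => //; exact/stepsP. Qed.

Let step_le_h : mesh_step Omega h x e <= h.
Proof.
by apply: ge_sup => [|s /stepsP[/andP[]]]; first by have [] := steps_sup.
Qed.

Lemma mesh_step_gt0 : 0 < mesh_step Omega h x e.
Proof.
have [r r0 rO] := open_normP Omega_open Ox.
pose s := Num.min h (r / (2 * (`|ivec R e| + 1))).
have e0 : 0 < `|ivec R e| + 1 by rewrite ltr_pwDr.
have s0 : 0 < s by rewrite lt_min h0 divr_gt0// mulr_gt0.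
apply: (lt_le_trans s0); apply: step_ub; first by rewrite ltW// ge_min lexx.
apply/subset_closure/rO; rewrite addrAC subrr add0r normrZ gtr0_norm//.
have : s <= r / (2 * (`|ivec R e| + 1)) by rewrite ge_min lexx orbT.
rewrite ler_pdivlMr ?mulr_gt0// => sr.
have : 0 <= s * `|ivec R e| by rewrite mulr_ge0// ltW.
lra.
Qed.

Lemma mesh_step_closure : closure Omega (x + mesh_step Omega h x e *: ivec R e).
Proof.
apply/closure_normP => eps eps0.
have e0 : 0 < `|ivec R e| + 1 by rewrite ltr_pwDr.
have r0 : 0 < eps / 2 / (`|ivec R e| + 1) by rewrite !divr_gt0.
have [s /stepsP[sh cls] sr] := sup_adherent r0 steps_sup.
have /closure_normP/(_ (eps / 2)) := cls.
rewrite divr_gt0// => /(_ isT)[y Oy ys]; exists y => //.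
have sle : s <= mesh_step Omega h x e.
  exact: step_ub.
set S := mesh_step _ _ _ _ in sle *.
rewrite (_ : y - _ = (y - (x + s *: ivec R e)) - (S - s) *: ivec R e); last first.
  by apply/rowP => i; rewrite !mxE; ring.
rewrite (le_lt_trans (ler_normB _ _))// [ltRHS]splitr ltrD//.
rewrite normrZ ger0_norm ?subr_ge0//.
move: sr; rewrite ltrBlDr -ltrBlDl ltr_pdivlMr// => /le_lt_trans; apply.
by rewrite ler_wpM2l ?subr_ge0// lerDl.
Qed.

Lemma mesh_step_full : closure Omega (x + h *: ivec R e) ->
  mesh_step Omega h x e = h.
Proof.
by move=> clh; apply/eqP; rewrite eq_le step_le_h step_ub// lexx ltW.
Qed.

Lemma mesh_step_le r : 0 < r < 1 -> ~ closure Omega (x + (r * h) *: ivec R e) ->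
  mesh_step Omega h x e <= r * h.
Proof.
move=> /andP[r0 r1] nclr; apply: ge_sup => [|s /stepsP[/andP[s0 sh] cls]].
  by have [] := steps_sup.
rewrite leNgt; apply/negP => rs; apply: nclr.
have s0' : 0 < s by rewrite (lt_trans _ rs)// mulr_gt0.
rewrite (_ : _ + _ = x + s *: ivec R e +
    (1 - r * h / s) *: (x - (x + s *: ivec R e))); last first.
  by apply/rowP => i; rewrite !mxE; field; rewrite gt_eqF.
apply: closure_convex_segment => //.
have : r * h / s <= 1 by rewrite ler_pdivrMr// mul1r ltW.
have : 0 <= r * h / s by rewrite divr_ge0// mulr_ge0// ltW.
lra.
Qed.

Lemma mesh_step_bdry : mesh_step Omega h x e < h ->
  bdry Omega (x + mesh_step Omega h x e *: ivec R e).
Proof.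
move=> sh; split; first exact: mesh_step_closure.
rewrite ((interior_id _).1 Omega_open) => OS.
have [r r0 rO] := open_normP Omega_open OS.
set S := mesh_step _ _ _ _ in sh OS rO.
pose t := Num.min (h - S) (r / (2 * (`|ivec R e| + 1))).
have e0 : 0 < `|ivec R e| + 1 by rewrite ltr_pwDr.
have t0 : 0 < t by rewrite lt_min subr_gt0 sh divr_gt0// mulr_gt0.
have tle : t <= h - S by rewrite ge_min lexx.
suff : S + t <= S by lra.
apply: step_ub; first by have := mesh_step_gt0; rewrite -/S; lra.
apply/subset_closure/rO.
rewrite (_ : _ - _ = t *: ivec R e) ?normrZ ?gtr0_norm//; last first.
  by apply/rowP => i; rewrite !mxE; ring.
have : t <= r / (2 * (`|ivec R e| + 1)) by rewrite ge_min lexx orbT.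
rewrite ler_pdivlMr ?mulr_gt0// => sr.
have : 0 <= t * `|ivec R e| by rewrite mulr_ge0// ltW.
lra.
Qed.

End Step.
Context (Omega : set 'rV[R]_d) (h : R) (u : 'rV[R]_d -> R).
Context (Omega_open : open Omega) (Omega_convex : convex_set Omega).
Context (h0 : 0 < h) (u_convex : discrete_convex Omega h u).

Lemma discrete_convex_midpoint x e : mesh_int Omega h x ->
  closure Omega (x + h *: ivec R e) -> closure Omega (x - h *: ivec R e) ->
  2 * u x <= u (x + h *: ivec R e) + u (x - h *: ivec R e).
Proof.
move=> xO xp xm; have [->|e0] := eqVneq e 0.
  rewrite (_ : ivec R 0 = 0) ?scaler0 ?subr0 ?addr0 ?mulr_natl ?mulr2n//.
  by apply/rowP => j; rewrite !mxE.
have Ox : Omega x by case: xO.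
have hp : mesh_step Omega h x e = h by exact: mesh_step_full.
have xm' : closure Omega (x + h *: ivec R (- e)) by rewrite ivecN scalerN.
have := u_convex xO e0; rewrite /discrete_delta hp (mesh_step_full h0 Ox xm').
move=> {hp xp xm xm'}.
move: (u _) (u _) (u _) => a c b.
rewrite pmulr_rge0 ?divr_gt0 ?addr_gt0// -mulrDl pmulr_lge0 ?invr_gt0//.
lra.
Qed.

(** Iterating the midpoint inequality along [x], [x + w], [x + 2 w],
    [x + 4 w], ... : the increment of [u] along a short lattice vector is
    controlled by its values far away.  This single estimate yields the
    equicontinuity of bounded discrete convex functions and the control of their
    values near the boundary. *)
Lemma discrete_convex_dyadic m x e : mesh_int Omega h x ->
  Omega (x + (2 ^ m)%:R *: (h *: ivec R e)) ->
  u (x + h *: ivec R e) - u x <=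
    (u (x + (2 ^ m)%:R *: (h *: ivec R e)) - u x) / (2 ^ m)%:R.
Proof.
move=> xO; have Ox : Omega x by case: xO.
elim: m e => [|m IH] e; first by rewrite expn0 scale1r divr1.
have scale2 k : (2 ^ k)%:R *: (h *: ivec R (e *+ 2)) =
    (2 ^ k.+1)%:R *: (h *: ivec R e).
  by rewrite ivecMn !scalerA expnS natrM; congr (_ *: _); ring.
have := IH (e *+ 2); rewrite scale2 => {}IH Oxm.
have two_gt0 k : 0 < (2 ^ k)%:R :> R by rewrite ltr0n expn_gt0.
have Oseg k : (k <= m.+1)%N -> Omega (x + (2 ^ k)%:R *: (h *: ivec R e)).
  move=> km; pose t : R := (2 ^ k)%:R / (2 ^ m.+1)%:R; have t01 : 0 <= t <= 1.
    by rewrite divr_ge0 ?(ltW (two_gt0 _))//= ler_pdivrMr// mul1r ler_nat leq_exp2l.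
  have := convex_set_segment Omega_convex Ox Oxm t01.
  by rewrite [X in _ *: X]addrAC subrr add0r (scalerA t) divfK ?gt_eqF.
have Oxe : Omega (x + h *: ivec R e).
  by have := Oseg 0%N isT; rewrite expn0 scale1r.
have xeO := mesh_intD xO Oxe.
have := discrete_convex_midpoint (e := e) xeO.
rewrite addrK -addrA -scalerDr -ivecD -mulr2n => mid.
have {}mid : 2 * u (x + h *: ivec R e) <= u (x + h *: ivec R (e *+ 2)) + u x.
  apply: mid; last exact: subset_closure.
  have := Oseg 1%N isT; rewrite -(scale2 0%N) expn0 scale1r.
  exact: subset_closure.
move: (IH Oxm) mid; move: (u _) (u _) (u _) (u _) => a Z c b IH' mid.
rewrite expnS natrM (_ : _ / _ = (Z - c) / (2 ^ m)%:R / 2); first by lra.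
by field; rewrite gt_eqF.
Qed.

(** Discrete convexity at [x] compares the slope over the step towards the
    boundary, of length at most [r * h], with the slope over the full step [h]
    backwards; the latter is at most [2 * M / h]. *)
Lemma discrete_convex_near_bdry M x e r :
  (forall y, mesh Omega h y -> `|u y| <= M) ->
  mesh_int Omega h x -> 0 < r < 1 -> Omega (x - h *: ivec R e) ->
  ~ closure Omega (x + (r * h) *: ivec R e) ->
  exists zeta, [/\ mesh_bdry Omega h zeta,
    `|zeta - x| <= r * `|h *: ivec R e| & u x <= u zeta + 2 * M * r].
Proof.
move=> uM xO r01 xeO nclx; have [Ox _] := xO; have /andP[r0 r1] := r01.
have xemesh : mesh_int Omega h (x - h *: ivec R e).
  by move: xeO; rewrite -scalerN -ivecN; exact: mesh_intD.
have e0 : e != 0.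
  apply/eqP => e0; apply: nclx; rewrite e0 (_ : ivec R 0 = 0).
    by rewrite scaler0 addr0; exact: subset_closure.
  by apply/rowP => j; rewrite !mxE.
set s := mesh_step Omega h x e.
have s0 : 0 < s by exact: mesh_step_gt0.
have sle : s <= r * h by exact: mesh_step_le.
have sh : s < h by rewrite (le_lt_trans sle)// gtr_pMl.
have zb : mesh_bdry Omega h (x + s *: ivec R e).
  by split; [exact: mesh_step_bdry|exists x, e].
exists (x + s *: ivec R e); split => //.
  rewrite addrAC subrr add0r !normrZ !gtr0_norm// mulrA ler_wpM2r//.
have := u_convex xO e0; rewrite /discrete_delta -/s.
rewrite (mesh_step_full (e := - e))//; last first.
  by rewrite ivecN scalerN; exact: subset_closure.
have uz := uM _ (or_intror zb); have ux := uM _ (or_introl xO).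
have uxe := uM _ (or_introl xemesh).
rewrite pmulr_rge0 ?divr_gt0 ?addr_gt0//.
move: (u _) (u _) (u _) ux uxe uz => a b c.
rewrite !ler_norml => /andP[a1 a2] /andP[b1 b2] /andP[c1 c2].
move=> dlt.
have : 0 <= s * ((a - c) / s + (b - c) / h) by rewrite mulr_ge0// ltW.
rewrite (_ : s * _ = a - c + s / h * (b - c)); last by field; rewrite !gt_eqF.
have : 0 <= s / h by rewrite divr_ge0// ltW.
have : s / h <= r by rewrite ler_pdivrMr.
nra.
Qed.

End Mesh.

(** * Contact points of affine functions with mesh functions *)

Section Contact.
Context {R : realType} {d : nat}.

Lemma mesh_int_finite (Omega : set 'rV[R]_d) h :
  bounded_set Omega -> 0 < h -> finite_set (mesh_int Omega h).
Proof.
move=> /bounded_setP[D D0 OD] h0.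
pose N := (Num.truncn (D / h)).+1.
pose F (k : {ffun 'I_d -> 'I_(N + N)}) : 'rV[R]_d :=
  h *: ivec R (\row_j ((k j)%:Z - N%:Z)).
apply: (@sub_finite_set _ _ (F @` setT)); last first.
  by apply: finite_image; exact: finite_finset.
move=> y [Oy [m _ ym]].
have mN j : (`|m 0%R j|%N < N)%N.
  have := OD _ Oy; rewrite -ym; move/(le_trans (coord_le_normv _ j)).
  rewrite !mxE normrM gtr0_norm// mulrC -ler_pdivlMr// => mD.
  rewrite -(ltr_nat R) natr_absz intr_norm.
  exact: le_lt_trans mD (truncnS_gt _).
have mN' j : (`|(m 0%R j + N%:Z)%R|%N < N + N)%N.
  by have := mN j; lia.
rewrite -ym; exists [ffun j => Ordinal (mN' j)] => //.
congr (_ *: ivec R _); apply/rowP => j; rewrite !mxE ffunE /=.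
by have := mN j; lia.
Qed.

(** The discrete form of Aleksandrov's argument: sliding up the affine function
    of slope [q], the first contact with the graph of [u] is at an interior mesh
    point, because on the boundary [u] is still above its affine minorant. *)
Lemma slope_in_discrete_subdiff (Omega : set 'rV[R]_d) h u x p b q m :
  bounded_set Omega -> 0 < h ->
  (forall y, mesh_bdry Omega h y -> dotv p y + b <= u y) ->
  mesh_int Omega h x -> u x <= dotv p x + b - m ->
  (forall y, mesh_bdry Omega h y -> dotv (q - p) (y - x) <= m) ->
  (\bigcup_(x in mesh_int Omega h) discrete_subdiff Omega h u x) q.
Proof.
move=> Ob h0 Lu xO ux qm.
have [x' x'O minx'] := finite_set_argmin (fun y => u y - dotv q y)
  (mesh_int_finite Ob h0) (ex_intro _ x xO).
exists x' => // y; rewrite dotvBr => -[/minx'|yb]; first lra.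
have := Lu _ yb; have := qm _ yb; have := minx' _ xO.
rewrite dotvDl dotvNl !dotvBr; lra.
Qed.

End Contact.

(** * Estimates at the boundary *)

Section Family.
Context {R : realType} {d : nat} (Omega : set 'rV[R]_d).
Context (Omega_open : open Omega) (Omega_nonempty : Omega !=set0).
Context (Omega_bounded : bounded_set Omega) (Omega_convex : convex_set Omega).
Context (h0 : R) (u : R -> 'rV[R]_d -> R) (M : R) (g : 'rV[R]_d -> R).
Context (h0_gt0 : 0 < h0).
Context (u_convex : forall h, 0 < h < h0 -> discrete_convex Omega h (u h)).
Context (u_bounded : forall h, 0 < h < h0 ->
  forall x, mesh Omega h x -> `|u h x| <= M).
Context (g_continuous : {within closure Omega, continuous g}).
Context (u_boundary : forall h, 0 < h < h0 ->
  forall x, mesh_bdry Omega h x -> u h x = g x).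

(** Near a boundary point [zeta], a lattice line through [x] and a fixed interior
    point leaves the domain right after [x]; convexity along this line bounds
    [u h x] by boundary values of [g] at points close to [zeta]. *)
Lemma discrete_convex_boundary_upper zeta eps : bdry Omega zeta -> 0 < eps ->
  exists2 eta, 0 < eta & forall h, 0 < h < eta -> forall x,
    mesh_int Omega h x -> `|x - zeta| < eta -> u h x <= g zeta + eps.
Proof.
move=> zb eps0; have [x0 Ox0] := Omega_nonempty.
have [D D0 OD] := bounded_setP Omega_bounded.
have [clz _] := zb; have eps20 : 0 < eps / 2 by rewrite divr_gt0.
have [del del0 gdel] := within_continuous_normP g_continuous clz eps20.
have [e e0 eO] := open_normP Omega_open Ox0.
have M0 : 0 <= `|M| by [].
pose r := Num.min (1 / 2) (Num.min (eps / (4 * (`|M| + 1))) (del / (4 * D))).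
have r0 : 0 < r.
  by rewrite !lt_min !divr_gt0// ?mulr_gt0// ltr_pwDr.
have r1 : r <= 1 / 2 by rewrite ge_min lexx.
have rM : r * (4 * (`|M| + 1)) <= eps.
  by rewrite -ler_pdivlMr ?mulr_gt0 ?ltr_pwDr// !ge_min lexx orbT.
have rD : r * (4 * D) <= del.
  by rewrite -ler_pdivlMr ?mulr_gt0// !ge_min lexx !orbT.
have [rho rho0 rhoO] : exists2 rho, 0 < rho & forall y,
    `|y - (zeta + r *: (zeta - x0))| < rho -> ~ closure Omega y.
  apply: (@open_normP _ _ (~` closure Omega)).
    by apply: closed_openC; exact: closed_closure.
  exact: outward_not_closure.
pose eta := Num.min (Num.min h0 e) (Num.min (rho / 4) (del / 2)).
have eta0 : 0 < eta by rewrite !lt_min h0_gt0 e0 !divr_gt0.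
exists eta => // h /andP[hgt0]; rewrite !lt_min => /andP[/andP[hh0 he] /andP[hrho hdel]].
move=> x xO; rewrite !lt_min => /andP[_ /andP[xrho xdel]].
have hh : 0 < h < h0 by rewrite hgt0.
have [Ox _] := xO; set y := mesh_round h x0.
have yx0 : `|y - x0| <= h := mesh_round_dist x0 hgt0.
have yO : mesh_int Omega h y by apply: mesh_int_round; apply: eO; exact: le_lt_trans he.
have [Oy _] := yO.
have [k kE] := mesh_intB yO xO.
have [|||xi [xib xix uxi]] := @discrete_convex_near_bdry R d Omega h (u h) Omega_open
  Omega_convex hgt0 (u_convex hh) M x k r (u_bounded hh) xO.
- by rewrite r0; lra.
- by rewrite -kE subKr.
- rewrite -scalerA -kE; apply: rhoO.
  rewrite (_ : _ - _ = (1 + r) *: (x - zeta) - r *: (y - x0)); last first.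
    by apply/rowP => j; rewrite !mxE; ring.
  rewrite (le_lt_trans (ler_normB _ _))// !normrZ !gtr0_norm; nra.
have xy : `|x - y| <= 2 * D.
  by rewrite (le_trans (ler_normB _ _))// mulr_natl mulr2n lerD// OD.
have xiz : `|xi - zeta| < del.
  rewrite -(subrK x xi) -addrA (le_lt_trans (ler_normD _ _))//.
  rewrite -kE in xix; nra.
have [[clxi _] _] := xib.
have := gdel xi clxi xiz; rewrite ltr_norml -(u_boundary hh xib) => /andP[_ gxi].
have : 2 * M * r <= eps / 2 by have := ler_norm M; nra.
lra.
Qed.

(** Aleksandrov's estimate: if [u h] were below [g zeta - eps] at a mesh point
    close to [zeta], then every slope [p + s * nu + q] would be a discrete
    subgradient, where [p] is the slope of an affine minorant of [g], [nu] is an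
    outward normal direction, [s] ranges up to a large bound and [q] is small.
    These slopes fill a parallelepiped that is arbitrarily long in the direction
    [nu]. *)
Lemma discrete_mass_boundary_lower (C : R) :
  (forall h, 0 < h < h0 -> (monge_ampere_mass Omega h (u h) <= C%:E)%E) ->
  convex_function (closure Omega) g -> forall zeta eps, bdry Omega zeta -> 0 < eps ->
  exists2 eta, 0 < eta & forall h, 0 < h < h0 -> forall x,
    mesh_int Omega h x -> `|x - zeta| < eta -> g zeta - eps <= u h x.
Proof.
move=> mass_le g_convex zeta eps zb eps0; have [x0 Ox0] := Omega_nonempty.
have [D D0 OD] := bounded_setP Omega_bounded.
have clD := closure_bounded OD.
have [clz _] := zb; have eps40 : 0 < eps / 4 by rewrite divr_gt0.
have [|p [b [Lg Lz]]] := affine_minorant (convex_set_closure Omega_convex)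
  g_convex clz _ eps40.
  move=> e e0; have [r r0 rg] := within_continuous_normP g_continuous clz e0.
  by exists r => // y Ay /(rg _ Ay); rewrite ltr_norml => /andP[+ _]; lra.
pose n : R := d%:R.
have n0 : 0 <= n by [].
(* [r] bounds the entries of [q], and [eta] is so small that the range of [s],
   [eps / (8 * (n + 1) * eta)], exceeds [|C| / r ^ (d - 1)] *)
pose r := eps / (8 * (n + 1) * D).
have r0 : 0 < r by rewrite divr_gt0// !mulr_gt0// ltr_pwDr.
have rE : r * (8 * (n + 1) * D) = eps.
  by rewrite divfK// gt_eqF// !mulr_gt0// ltr_pwDr.
have rd0 : 0 < r ^+ d.-1 by rewrite exprn_gt0.
pose eta := Num.min (eps / (4 * (n + 1) * (`|p| + 1)))
  (eps * r ^+ d.-1 / (8 * (n + 1) * (`|C| + 1))).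
have eta0 : 0 < eta by rewrite lt_min !divr_gt0// !mulr_gt0// ltr_pwDr.
have etap : eta * (4 * (n + 1) * (`|p| + 1)) <= eps.
  by rewrite -ler_pdivlMr ?ge_min ?lexx// !mulr_gt0// ltr_pwDr.
have etaC : eta * (8 * (n + 1) * (`|C| + 1)) <= eps * r ^+ d.-1.
  by rewrite -ler_pdivlMr ?ge_min ?lexx ?orbT// !mulr_gt0// ltr_pwDr.
exists eta => // h hh x xO xz; have [hgt0 _] := andP hh; have [Ox _] := xO.
rewrite leNgt; apply/negP => ux.
(* a point outside of the domain at distance at most [eta] from [zeta]; its
   separation from the domain gives a nearly supporting hyperplane at [zeta] *)
pose t := eta / (`|zeta - x0| + 1).
have t0 : 0 < t by rewrite divr_gt0// ltr_pwDr.
have [w [e e0 we]] : exists w, exists2 e, 0 < e & forall y, closure Omega y ->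
    dotv w (y - (zeta + t *: (zeta - x0))) <= - e.
  apply: separation; first exact: convex_set_closure.
    by exists zeta.
  rewrite -((closure_id _).1 (@closed_closure _ Omega)).
  exact: outward_not_closure.
set z := zeta + _ in we.
have zx : `|z - x| <= 2 * eta.
  rewrite (_ : z - x = (zeta - x) + t *: (zeta - x0)); last by rewrite /z addrAC.
  rewrite (le_trans (ler_normD _ _))// distrC normrZ gtr0_norm//.
  have : t * `|zeta - x0| <= eta.
    by rewrite /t mulrAC ler_pdivrMr ?ltr_pwDr// ler_wpM2l ?(ltW eta0)// lerDl.
  lra.
have w0 : `|w| != 0.
  rewrite normr_eq0; apply/eqP => w0; have := we x0 (subset_closure Ox0).
  by rewrite w0 -(scale0r (0 : 'rV_d)) dotvZl mul0r; lra.
have [i wi] := normv_coord w0.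
pose nu := `|w|^-1 *: w.
have wgt0 : 0 < `|w| by rewrite lt_def w0 /=.
have nui : `|nu 0 i| = 1.
  by rewrite mxE normrM normfV normr_id wi mulVf.
have nu1 : `|nu| = 1 by rewrite normrZ normfV normr_id mulVf.
have nuy y : closure Omega y -> dotv nu (y - x) <= 2 * n * eta.
  move=> Oy; rewrite -(subrKA z) dotvDr.
  have : dotv nu (y - z) <= 0.
    by rewrite dotvZl pmulr_rle0 ?invr_gt0//; have := we _ Oy; lra.
  have := dotv_norm_le nu (z - x); rewrite nu1 mulr1 -/n => /ler_normlW.
  nra.
(* the increments over the domain of [s * nu] and of [q] are both at most
   [eps / 4] *)
pose s := eps / (8 * (n + 1) * eta).
have s0 : 0 < s by rewrite divr_gt0// !mulr_gt0// ltr_pwDr.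
have sE : s * (8 * (n + 1) * eta) = eps.
  by rewrite divfK// gt_eqF// !mulr_gt0// ltr_pwDr.
pose l : 'rV[R]_d := \row_j if j == i then s else r.
have l0 j : 0 < l 0 j by rewrite mxE; case: ifP.
have : ((\prod_j l 0 j)%:E <= monge_ampere_mass Omega h (u h))%E.
  apply: (lebesgue_vol_ge_slanted_box (o := p) nui l0) => t' t'l.
  apply: (slope_in_discrete_subdiff (p := p) (b := b) (m := eps / 2)
    Omega_bounded hgt0 _ xO).
  - by move=> y yb; rewrite (u_boundary hh yb); apply: Lg; have [[]] := yb.
  - have : dotv p zeta - dotv p x <= eps / 4.
      rewrite -dotvBr; apply: (le_trans (ler_norm _)).
      rewrite (le_trans (dotv_norm_le _ _))// -/n distrC.
      apply: (@le_trans _ _ (n * `|p| * eta)).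
        by rewrite ler_wpM2l ?mulr_ge0// ltW.
      have : 0 <= eta * n by rewrite mulr_ge0// ltW.
      have : 0 <= eta * `|p| by rewrite mulr_ge0// ltW.
      lra.
    lra.
  move=> y [[cly _] _].
  rewrite dotv_slant.
  have -> : eps / 2 = eps / 4 + eps / 4 by lra.
  apply: lerD.
    have /andP[ti0] := t'l i; rewrite mxE eqxx => tis.
    have nt0 : 0 <= 2 * n * eta by rewrite !mulr_ge0// ltW.
    apply: (le_trans (ler_wpM2l ti0 (nuy y cly))).
    apply: (le_trans (ler_wpM2r nt0 tis)).
    have : 0 <= s * eta by rewrite mulr_ge0 ?ltW.
    lra.
  apply: (@le_trans _ _ (\sum_(j < d) r * (2 * D))).
    apply: ler_sum => j _; rewrite (le_trans (ler_norm _))// normrM ler_pM//.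
      case: (eqVneq j i) => [|ji]; first by rewrite normr0 ltW.
      have := t'l j; rewrite mxE (negbTE ji) => /andP[tj0 tjr].
      by rewrite ger0_norm.
    rewrite (le_trans (coord_le_normv _ _))// (le_trans (ler_normB _ _))//.
    by rewrite mulr_natl mulr2n lerD// clD//; exact: subset_closure.
  by rewrite sumr_const card_ord -[leLHS]mulr_natl -/n; nra.
move=> /le_trans/(_ (mass_le h hh)); rewrite lee_fin.
rewrite (bigD1 i)//= [l 0 i]mxE eqxx (eq_bigr (fun=> r)) => [|j ji]; last first.
  by rewrite mxE (negbTE ji).
rewrite prodr_const cardC1 card_ord => sC.
have K0 : 0 < 8 * (n + 1) * eta by rewrite !mulr_gt0// ltr_pwDr.
have : (s * r ^+ d.-1) * (8 * (n + 1) * eta) <= C * (8 * (n + 1) * eta).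
  by rewrite ler_pM2r.
rewrite mulrAC sE; have := ler_norm C; nra.
Qed.

End Family.

(** * Limits along an ultrafilter *)

Section UltraLimit.
Context {R : realType}.

Lemma ultra_bounded_cvg (T : Type) (U : set_system T) (f : T -> R) (M : R) :
  UltraFilter U -> (\forall t \near U, `|f t| <= M) ->
  exists l : R, f t @[t --> U] --> l.
Proof.
move=> UU fM.
have fU : UltraFilter (f @ U).
  split=> [|G GF sG]; first exact: fmap_proper_filter.
  apply/seteqP; split => // A GA.
  have [//|nA] := in_ultra_setVsetC (f @^-1` A) UU.
  have /filter_ex[x []//] : G (A `&` ~` A) by apply: filterI => //; exact: sG.
have : (f @ U) `[-M, M]%classic.
  by apply: filterS fM => t; rewrite /= in_itv/= ler_norml.
have := @segment_compact R (- M) M; rewrite compact_ultra => /(_ _ fU) /[apply].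
by move=> [l [_ fl]]; exists l.
Qed.

Lemma exists_pow2_inv_le (c e : R) : 0 < e -> exists m, c / (2 ^ m)%:R <= e.
Proof.
move=> e0; exists (Num.truncn (c / e)).+1.
rewrite ler_pdivrMr ?ltr0n ?expn_gt0// mulrC -ler_pdivrMr//.
rewrite (le_trans (ltW (truncnS_gt _)))// ler_nat ltnW//.
by rewrite (leq_trans (ltnSn _))// ltn_expl.
Qed.

(** Reflecting a point of the segment through it towards the nearest endpoint
    shows that an upper bound of a midpoint convex function with nonpositive
    endpoint values can be halved. *)
Lemma midpoint_convex_le0 (f : R -> R) (B : R) :
  (forall t, 0 <= t <= 1 -> f t <= B) -> f 0 <= 0 -> f 1 <= 0 ->
  (forall t s, 0 <= t - s -> t + s <= 1 -> 0 <= s ->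
     2 * f t <= f (t + s) + f (t - s)) ->
  forall t, 0 <= t <= 1 -> f t <= 0.
Proof.
move=> fB f0 f1 fmid.
have halve m : forall t, 0 <= t <= 1 -> f t <= `|B| / (2 ^ m)%:R.
  elim: m => [|m IH] t t01.
    by rewrite divr1 (le_trans (fB _ t01))// ler_norm.
  have -> : `|B| / (2 ^ m.+1)%:R = `|B| / (2 ^ m)%:R / 2.
    by rewrite expnS natrM; field; rewrite gt_eqF// ltr0n expn_gt0.
  have [t12|t12] := lerP t (1 / 2).
    have := fmid t t; rewrite subrr => /(_ (lexx _)).
    have := IH (t + t); lra.
  have := fmid t (1 - t); rewrite subrKC.
  have := IH (t - (1 - t)); lra.
move=> t t01; apply/ler_addgt0Pr => e e0; rewrite add0r.
by have [m Be] := exists_pow2_inv_le `|B| e0; exact: le_trans (halve m _ t01) Be.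
Qed.

Lemma near_forall_compact n (U : set_system R) (K : set 'rV[R]_n)
    (P : R -> 'rV[R]_n -> Prop) : Filter U -> compact K ->
  (forall x, K x -> exists2 s, 0 < s & \forall h \near U, forall y, K y ->
    `|y - x| < s -> P h y) ->
  \forall h \near U, forall y, K y -> P h y.
Proof.
move=> UF /compact_near_coveringP/near_covering_withinP Kc loc.
apply: Kc => x /loc[s s0 us].
exists (ball x s, [set h | forall y, K y -> `|y - x| < s -> P h y]).
  by split => //; exact: nbhsx_ballx.
move=> [y h] /= [xy uh] Ky; apply: uh => //.
by move: xy; rewrite -ball_normE/= distrC.
Qed.

End UltraLimit.

(** * The limit of a bounded family of discrete convex functions *)

Section Limit.
Context {R : realType} {d : nat} (Omega : set 'rV[R]_d).
Context (Omega_open : open Omega) (Omega_nonempty : Omega !=set0).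
Context (Omega_bounded : bounded_set Omega) (Omega_convex : convex_set Omega).
Context (h0 : R) (u : R -> 'rV[R]_d -> R) (M : R).
Context (h0_gt0 : 0 < h0).
Context (u_convex : forall h, 0 < h < h0 -> discrete_convex Omega h (u h)).
Context (u_bounded : forall h, 0 < h < h0 ->
  forall x, mesh Omega h x -> `|u h x| <= M).
Context (U : set_system R) (U_ultra : UltraFilter U).
Context (U_right0 : 0^'+ `<=` U).

Lemma near_small (e : R) : 0 < e -> \forall h \near U, 0 < h < e.
Proof.
move=> e0; apply: U_right0; near=> h; apply/andP; split.
  by near: h; exact: nbhs_right_gt.
by near: h; exact: nbhs_right_lt.
Unshelve. all: by end_near. Qed.

Lemma near_mesh_round x : Omega x ->
  \forall h \near U, mesh_int Omega h (mesh_round h x).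
Proof.
move=> Ox; have [e e0 eO] := open_normP Omega_open Ox.
apply: filterS (near_small e0) => h /andP[hgt0 he].
by apply/mesh_int_round/eO/(le_lt_trans _ he)/mesh_round_dist.
Qed.

(** Any lattice points converging to [x] would do instead of [mesh_round h x], by
    equicontinuity; see [ulimit_near]. *)
Definition ulimit x : R := lim (u h (mesh_round h x) @[h --> U]).

Lemma ulimit_cvg x : Omega x -> u h (mesh_round h x) @[h --> U] --> ulimit x.
Proof.
move=> Ox; suff [l ul] : exists l : R, u h (mesh_round h x) @[h --> U] --> l.
  by apply: cvg_trans (ul) _; rewrite /ulimit (cvg_lim _ ul)//.
apply: (ultra_bounded_cvg U_ultra (M := M)).
apply: filterS2 (near_small h0_gt0) (near_mesh_round Ox) => h hh xO.
by apply: u_bounded => //; left.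
Qed.

Lemma ulimit_bounded x : Omega x -> `|ulimit x| <= M.
Proof.
move=> Ox; apply/ler_addgt0Pr => e e0.
have /cvgrPdist_le/(_ _ e0) uv := ulimit_cvg Ox.
have [h [[hh xO] uvh]] := @filter_ex _ U _ _
  (filterI (filterI (near_small h0_gt0) (near_mesh_round Ox)) uv).
have := u_bounded hh (or_introl xO); move: uvh.
by rewrite !ler_norml => /andP[? ?] /andP[? ?]; apply/andP; split; lra.
Qed.

Lemma ulimit_closed (P : set R) z s x : closed P -> 0 < s ->
  (forall h, 0 < h < s -> forall y, mesh_int Omega h y -> `|y - z| < s -> P (u h y)) ->
  Omega x -> `|x - z| < s / 2 -> P (ulimit x).
Proof.
move=> Pc s0 uP Ox xz; apply: (closed_cvg _ Pc _ _ (ulimit_cvg Ox)).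
have s20 : 0 < s / 2 by rewrite divr_gt0.
apply: filterS2 (near_small s20) (near_mesh_round Ox) => h /andP[hgt0 hs] xO.
apply: uP => //; first by rewrite hgt0; lra.
have := ler_normD (mesh_round h x - x) (x - z); rewrite subrKA.
have := mesh_round_dist x hgt0; lra.
Qed.

(** A short increment can be doubled [m] times without leaving the domain, so it
    changes [u h] by at most [2 * M / 2 ^ m]. *)
Lemma discrete_convex_equicontinuous x e : Omega x -> 0 < e ->
  exists2 s, 0 < s & forall h, 0 < h < h0 -> forall y z,
    mesh_int Omega h y -> mesh_int Omega h z -> `|y - x| < s -> `|z - x| < s ->
    `|u h z - u h y| <= e.
Proof.
move=> Ox e0; have [r r0 rO] := open_normP Omega_open Ox.
have [m mM] := exists_pow2_inv_le (2 * M) e0.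
have p0 : 0 < (2 ^ m)%:R :> R by rewrite ltr0n expn_gt0.
pose s := r / (4 * (2 ^ m)%:R).
have s0 : 0 < s by rewrite divr_gt0// mulr_gt0.
have sE : s * (4 * (2 ^ m)%:R) = r by rewrite divfK// gt_eqF// mulr_gt0.
exists s => // h hh.
have p1 : 1 <= (2 ^ m)%:R :> R by rewrite ler1n expn_gt0.
suff inc y z : mesh_int Omega h y -> mesh_int Omega h z ->
    `|y - x| < s -> `|z - x| < s -> u h z - u h y <= e.
  move=> y z yO zO ys zs; rewrite ler_norml inc// andbT.
  by have := inc z y zO yO zs ys; lra.
move=> yO zO ys zs; have /andP[hgt0 _] := hh.
have [k kE] := mesh_intB yO zO.
have yzO : Omega (y + (2 ^ m)%:R *: (h *: ivec R k)).
  apply: rO; rewrite -kE.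
  rewrite (_ : _ - x = (y - x) + (2 ^ m)%:R *: ((z - x) - (y - x))); last first.
    by apply/rowP => j; rewrite !mxE; ring.
  rewrite (le_lt_trans (ler_normD _ _))// normrZ gtr0_norm//.
  have := ler_normB (z - x) (y - x).
  move: (`|z - x - (y - x)|) (`|z - x|) (`|y - x|) ys zs => a b c cs bs abc.
  nra.
have := discrete_convex_dyadic Omega_convex hgt0 (u_convex hh) yO yzO.
rewrite -kE subrKC => /le_trans; apply; apply: le_trans mM.
rewrite ler_pM2r ?invr_gt0//.
have := u_bounded hh (or_introl yO).
have [_ [k' _ yE]] := yO.
have : mesh_int Omega h (y + (2 ^ m)%:R *: (z - y)).
  by split; [rewrite kE|exists (k' + k *+ (2 ^ m)) => //;
    rewrite ivecD ivecMn kE -yE scalerDr !scalerA (mulrC h)].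
move=> /or_introl/(u_bounded hh).
by rewrite !ler_norml => /andP[_ ?] /andP[? _]; lra.
Qed.

Lemma ulimit_near x e : Omega x -> 0 < e ->
  exists2 s, 0 < s & \forall h \near U, forall y,
    mesh_int Omega h y -> `|y - x| < s -> `|u h y - ulimit x| <= e.
Proof.
move=> Ox e0; have e20 : 0 < e / 2 by rewrite divr_gt0.
have [s s0 us] := discrete_convex_equicontinuous Ox e20.
exists s => //; have /cvgrPdist_le/(_ _ e20) ux := ulimit_cvg Ox.
have smin : 0 < Num.min s h0 by rewrite lt_min s0.
apply: filterS3 (near_small smin) (near_mesh_round Ox) ux => h.
rewrite lt_min => /and3P[hgt0 hs hh0] xO uxh y yO yx.
have hh : 0 < h < h0 by rewrite hgt0.
have := us _ hh _ _ xO yO (le_lt_trans (mesh_round_dist x hgt0) hs) yx.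
move: uxh; rewrite !ler_norml => /andP[? ?] /andP[? ?]; lra.
Qed.

Lemma ulimit_continuous x e : Omega x -> 0 < e ->
  exists2 s, 0 < s & forall y, Omega y -> `|y - x| < s ->
    `|ulimit y - ulimit x| <= e.
Proof.
move=> Ox e0; have [s s0 us] := ulimit_near Ox e0.
exists (s / 2) => [|y Oy yx]; first by rewrite divr_gt0.
apply/ler_addgt0Pr => e' e'0.
have s20 : 0 < s / 2 by rewrite divr_gt0.
have /cvgrPdist_le/(_ _ e'0) uy := ulimit_cvg Oy.
have [h [[[/andP[hgt0 hs] ush] yO] uyh]] := @filter_ex _ U _ _
  (filterI (filterI (filterI (near_small s20) us) (near_mesh_round Oy)) uy).
have := ush _ yO; rewrite -(subrK y (mesh_round h y)) -addrA subrK.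
have -> : `|mesh_round h y - y + (y - x)| < s.
  have := ler_normD (mesh_round h y - y) (y - x).
  have := mesh_round_dist y hgt0; lra.
move=> /(_ isT); move: uyh; rewrite !ler_norml => /andP[? ?] /andP[? ?]; lra.
Qed.

Lemma ulimit_near_diag x e : Omega x -> 0 < e ->
  exists2 s, 0 < s & \forall h \near U, forall y,
    mesh_int Omega h y -> `|y - x| < s -> `|u h y - ulimit y| <= e.
Proof.
move=> Ox e0; have e20 : 0 < e / 2 by rewrite divr_gt0.
have [s s0 us] := ulimit_near Ox e20; have [t t0 vt] := ulimit_continuous Ox e20.
exists (Num.min s t); first by rewrite lt_min s0.
apply: filterS us => h us y yO; rewrite lt_min => /andP[ys yt].
have [Oy _] := yO; have := us _ yO ys; have := vt _ Oy yt.
by rewrite !ler_norml => /andP[? ?] /andP[? ?]; lra.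
Qed.

(** Up to an error [h], every vector [w] is [h] times an integral direction, and
    discrete convexity in all integral directions gives the midpoint inequality at
    the mesh. *)
Lemma ulimit_midpoint x w : Omega (x + w) -> Omega (x - w) ->
  2 * ulimit x <= ulimit (x + w) + ulimit (x - w).
Proof.
move=> Oxp Oxm; have Ox : Omega x.
  rewrite (_ : x = (x + w) + (1 / 2) *: ((x - w) - (x + w))).
    by apply: convex_set_segment => //; lra.
  by apply/rowP => j; rewrite !mxE; field.
apply/ler_addgt0Pr => e e0; have e40 : 0 < e / 4 by rewrite divr_gt0.
have [s s0 us] := ulimit_near Ox e40.
have [sp sp0 usp] := ulimit_near Oxp e40.
have [sm sm0 usm] := ulimit_near Oxm e40.
have [rp rp0 rpO] := open_normP Omega_open Oxp.
have [rm rm0 rmO] := open_normP Omega_open Oxm.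
pose t := Num.min s (Num.min (Num.min sp sm) (Num.min rp rm)) / 2.
have t0 : 0 < Num.min t h0 by rewrite lt_min h0_gt0 divr_gt0// !lt_min s0 sp0 sm0 rp0.
have [h [[[[hs xO] ush] usph] usmh]] := @filter_ex _ U _ _
  (filterI (filterI (filterI (filterI (near_small t0) (near_mesh_round Ox)) us) usp) usm).
move: hs; rewrite lt_min /t => /and3P[hgt0 + hh0].
rewrite ltr_pdivlMr// !lt_min => /and3P[hs /andP[hsp hsm] /andP[hrp hrm]].
have hh : 0 < h < h0 by rewrite hgt0.
set y := mesh_round h x in xO; pose k : 'rV[int]_d := \row_j Num.floor (w 0 j / h).
have yx : `|y - x| <= h := mesh_round_dist x hgt0.
have kw : `|h *: ivec R k - w| <= h := mesh_round_dist w hgt0.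
have yp : `|y + h *: ivec R k - (x + w)| <= h * 2.
  rewrite opprD addrACA (le_trans (ler_normD _ _))//; lra.
have ym : `|y - h *: ivec R k - (x - w)| <= h * 2.
  rewrite (_ : _ - _ = (y - x) - (h *: ivec R k - w)).
    by rewrite (le_trans (ler_normB _ _))//; lra.
  by apply/rowP => j; rewrite !mxE; ring.
have ypO : mesh_int Omega h (y + h *: ivec R k).
  by apply: mesh_intD => //; apply: rpO; exact: le_lt_trans hrp.
have ymO : mesh_int Omega h (y - h *: ivec R k).
  rewrite -scalerN -ivecN; apply: mesh_intD => //.
  by rewrite ivecN scalerN; apply: rmO; exact: le_lt_trans hrm.
have := ush _ xO; rewrite (le_lt_trans yx) => [/(_ isT)|]; last by lra.
have := usph _ ypO (le_lt_trans yp hsp); have := usmh _ ymO (le_lt_trans ym hsm).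
have := discrete_convex_midpoint hgt0 (u_convex hh) xO
  (subset_closure ypO.1) (subset_closure ymO.1).
move: (u h _) (u h _) (u h _) => a b c.
by rewrite !ler_norml => mid /andP[? ?] /andP[? ?] /andP[? ?]; lra.
Qed.

Lemma ulimit_convex : convex_function Omega ulimit.
Proof.
move=> l x y; rewrite !inE => Ox Oy.
rewrite /conv/= /conv/= /unstable.onem.
have t0 : 0 <= l%:num by []; have t1 : l%:num <= 1 by [].
move: (l%:num : R) t0 t1 => t t0 t1 {l}.
pose pt s : 'rV[R]_d := y + s *: (x - y).
have Opt s : 0 <= s <= 1 -> Omega (pt s) by exact: convex_set_segment.
have pt0 : pt 0 = y by rewrite /pt scale0r addr0.
have pt1 : pt 1 = x by rewrite /pt scale1r subrKC.
pose f s := ulimit (pt s) - (ulimit y + s * (ulimit x - ulimit y)).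
suff : f t <= 0.
  rewrite /f (_ : pt t = t *: x + (1 - t) *: y); last first.
    by apply/rowP => j; rewrite !mxE; ring.
  by rewrite subr_le0 => /le_trans; apply; rewrite /GRing.scale/=; lra.
apply: (@midpoint_convex_le0 _ f (M - ulimit y + `|ulimit x - ulimit y|)) => //.
- move=> s s01; have := ulimit_bounded (Opt _ s01); rewrite /f ler_norml => /andP[_].
  have := ler_norm (- (ulimit x - ulimit y)); rewrite normrN.
  have := normr_ge0 (ulimit x - ulimit y); case/andP: s01 => s0 s1; nra.
- by rewrite /f pt0 mul0r addr0 subrr.
- by rewrite /f pt1; lra.
- move=> s r sr0 sr1 r0; rewrite /f.
  have ptD : pt (s + r) = pt s + r *: (x - y) by rewrite /pt scalerDl addrA.
  have ptB : pt (s - r) = pt s - r *: (x - y) by rewrite /pt scalerBl addrA.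
  have := @ulimit_midpoint (pt s) (r *: (x - y)); rewrite -ptD -ptB.
  move=> /(_ (Opt _ _) (Opt _ _)).
  have -> : 0 <= s + r <= 1 by lra.
  have -> : 0 <= s - r <= 1 by lra.
  move=> /(_ isT isT).
  move: (ulimit _) (ulimit _) (ulimit _) (ulimit _) (ulimit _) => a b c v w.
  by lra.
- exact/andP.
Qed.

(** An affine minorant of [u h] does not decrease from [y] to a suitable corner of
    the lattice cell of [y], where it is at most [u h]. *)
Lemma convex_envelope_near_le x e : Omega x -> 0 < e ->
  exists2 s, 0 < s & \forall h \near U, forall y, `|y - x| < s ->
    (convex_envelope Omega h (u h) y <= (ulimit x + e)%:E)%E.
Proof.
move=> Ox e0; have [s s0 us] := ulimit_near Ox e0.
have [r r0 rO] := open_normP Omega_open Ox.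
pose t := Num.min s r / 2.
have t0 : 0 < t by rewrite divr_gt0// lt_min s0.
exists t => //; apply: filterS2 (near_small t0) us => h /andP[hgt0 ht] us y yx.
apply: ge_ereal_sup => _ [[p b] /= pb <-]; rewrite lee_fin.
pose c j : int := if 0 <= p 0 j then Num.floor (y 0 j / h) + 1 else Num.floor (y 0 j / h).
pose z : 'rV[R]_d := h *: ivec R (\row_j c j).
have zj j : z 0 j = h * (c j)%:~R by rewrite !mxE.
have fl j := floor_itv (y 0 j / h).
have zy : `|z - y| <= h.
  apply: normv_le => [|j]; first exact: ltW.
  have /andP[f1 f2] := fl j.
  rewrite (_ : (z - y) 0 j = z 0 j - y 0 j) ?zj /c; last by rewrite !mxE.
  move: f1 f2; rewrite intrD1 ler_pdivlMr// ltr_pdivrMr// => f1 f2.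
  by rewrite ler_norml; case: ifP => _; rewrite ?intrD1; lra.
have pyz : dotv p y <= dotv p z.
  apply: ler_sum => j _; have /andP[f1 f2] := fl j; rewrite zj /c.
  move: f1 f2; rewrite intrD1 ler_pdivlMr// ltr_pdivrMr// => f1 f2.
  case: ifPn => [p0|]; first by rewrite ler_wpM2l// intrD1; lra.
  by rewrite -ltNge => p0; rewrite ler_wnM2l//; lra.
have zx : `|z - x| < Num.min s r.
  have := ler_normD (z - y) (y - x); rewrite subrKA.
  have : t * 2 = Num.min s r by rewrite divfK.
  lra.
move: zx; rewrite lt_min => /andP[zs zr].
have zO : mesh_int Omega h z by split; [exact: rO|eexists].
have := us z zO zs; have := pb z (or_introl zO).
by rewrite ler_norml => ? /andP[_ ?]; lra.
Qed.

Section Boundary.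
Context (g : 'rV[R]_d -> R).
Context (u_boundary : forall h, 0 < h < h0 ->
  forall x, mesh_bdry Omega h x -> u h x = g x).
Context (boundary_upper : forall zeta eps, bdry Omega zeta -> 0 < eps ->
  exists2 eta, 0 < eta & forall h, 0 < h < eta -> forall x,
    mesh_int Omega h x -> `|x - zeta| < eta -> u h x <= g zeta + eps).

Lemma ulimit_boundary_upper zeta e : bdry Omega zeta -> 0 < e ->
  exists2 s, 0 < s & forall x, Omega x -> `|x - zeta| < s -> ulimit x <= g zeta + e.
Proof.
move=> zb e0; have [s s0 us] := boundary_upper zb e0.
exists (s / 2) => [|x Ox xz]; first by rewrite divr_gt0.
exact: (ulimit_closed (@closed_le _ (g zeta + e)) s0 us Ox xz).
Qed.

(** Near [zeta] the affine function is below the limit, whose upper limit at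
    [zeta] is at most [g zeta]. *)
Lemma affine_le_boundary p b zeta : bdry Omega zeta ->
  (forall y, Omega y -> dotv p y + b <= ulimit y) -> dotv p zeta + b <= g zeta.
Proof.
move=> zb Lv; apply/ler_addgt0Pr => e e0.
have e20 : 0 < e / 2 by rewrite divr_gt0.
have [s s0 vs] := ulimit_boundary_upper zb e20.
have [clz _] := zb; have P0 : 0 < d%:R * `|p| + 1 by rewrite ltr_pwDr ?mulr_ge0.
have t0 : 0 < Num.min s (e / 2 / (d%:R * `|p| + 1)) by rewrite lt_min s0 divr_gt0.
have [x Ox] := (closure_normP _ _).1 clz _ t0.
rewrite lt_min => /andP[xs xp].
have := vs x Ox xs; have := Lv x Ox.
have := dotv_norm_le p (x - zeta); rewrite dotvBr ler_norml => /andP[+ _].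
have := xp; rewrite ltr_pdivlMr// mulrDr mulr1.
have := normr_ge0 (x - zeta); move: (d%:R * _) (`|x - _|) => P X.
lra.
Qed.

(** An affine minorant of the limit is asymptotically a minorant of [u h] up to
    the boundary: moving from [y] by a small fraction [2 ^ - m] of the way to an
    interior point reaches a compact subset, where [u h] is close to its limit,
    and increases [u h] by [O(2 ^ - m)] at most. *)
Lemma affine_le_mesh_int_near p b e z :
  (forall y, Omega y -> dotv p y + b <= ulimit y) -> 0 < e -> closure Omega z ->
  exists2 s, 0 < s & \forall h \near U, forall y, mesh_int Omega h y ->
    `|y - z| < s -> dotv p y + b - e <= u h y.
Proof.
move=> Lv e0 clz; have [x0 Ox0] := Omega_nonempty.
have [D D0 OD] := bounded_setP Omega_bounded.
pose N := d%:R * `|p|; have N0 : 0 <= N by rewrite mulr_ge0.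
have e40 : 0 < e / 4 by rewrite divr_gt0.
have [m mE] := exists_pow2_inv_le (2 * M + N * (2 * D)) e40.
have p0 : 0 < (2 ^ m)%:R :> R by rewrite ltr0n expn_gt0.
pose th : R := (2 ^ m)%:R^-1.
have th0 : 0 < th by rewrite invr_gt0.
have th1 : th <= 1 by rewrite invf_le1// ler1n expn_gt0.
have thE : (2 ^ m)%:R * th = 1 by rewrite mulfV// gt_eqF.
pose z' := z + th *: (x0 - z).
have Oz' : Omega z' by apply: closure_segment_interior; rewrite ?th0.
have [s1 s10 us] := ulimit_near Oz' e40.
have [r r0 rO] := open_normP Omega_open Ox0.
have [r' r'0 r'O] := open_normP Omega_open Oz'.
pose s := Num.min (Num.min s1 r' / 2) (e / 4 / (N + 1)).
have s0 : 0 < s by rewrite lt_min !divr_gt0 ?lt_min ?s10// ltr_pwDr.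
pose t := Num.min (Num.min h0 (r * th)) (Num.min s1 r' / 2).
have t0 : 0 < t by rewrite !lt_min h0_gt0 mulr_gt0// divr_gt0// lt_min s10.
exists s => //; apply: filterS2 (near_small t0) us => h.
move=> /andP[hgt0]; rewrite !lt_min => /andP[/andP[hh0 hr] hs1] us y yO.
rewrite lt_min => /andP[ys1]; rewrite ltr_pdivlMr ?ltr_pwDr// => yN.
have hh : 0 < h < h0 by rewrite hgt0.
pose k : 'rV[int]_d := \row_j Num.floor ((th *: (x0 - y)) 0 j / h).
have wE : `|h *: ivec R k - th *: (x0 - y)| <= h := mesh_round_dist _ hgt0.
have zz : `|y + h *: ivec R k - z'| < Num.min s1 r'.
  rewrite (_ : _ - z' =
    (1 - th) *: (y - z) + (h *: ivec R k - th *: (x0 - y))); last first.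
    by apply/rowP => j; rewrite !mxE; ring.
  have := ler_normD ((1 - th) *: (y - z)) (h *: ivec R k - th *: (x0 - y)).
  have : `|(1 - th) *: (y - z)| <= `|y - z|.
    by rewrite normrZ ger0_norm ?subr_ge0// ler_piMl// gerBl ltW.
  move: wE ys1 hs1; set K := Num.min s1 r'; set a := `|_ - th *: _|; set c := `|_ + _|.
  by move=> *; lra.
move: zz; rewrite lt_min => /andP[zs1 zr'].
have zO : mesh_int Omega h (y + h *: ivec R k) by apply: mesh_intD => //; exact: r'O.
have yfar : Omega (y + (2 ^ m)%:R *: (h *: ivec R k)).
  apply: rO.
  rewrite (_ : _ - x0 = (2 ^ m)%:R *: (h *: ivec R k - th *: (x0 - y))); last first.
    by rewrite scalerBr (scalerA _ th) thE scale1r opprB addrAC addrC.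
  rewrite normrZ gtr0_norm// (le_lt_trans (ler_wpM2l (ltW p0) wE))//.
  by rewrite mulrC -ltr_pdivlMr.
have farO : mesh_int Omega h (y + (2 ^ m)%:R *: (h *: ivec R k)).
  have [_ [k' _ yE]] := yO; split=> //; exists (k' + k *+ (2 ^ m)) => //.
  by rewrite ivecD ivecMn -yE scalerDr !scalerA (mulrC h).
have dya := discrete_convex_dyadic Omega_convex hgt0 (u_convex hh) yO yfar.
have uy := us _ zO zs1; have Lz := Lv _ Oz'.
have ub1 := u_bounded hh (or_introl farO); have ub2 := u_bounded hh (or_introl yO).
have inc : u h (y + h *: ivec R k) - u h y <= 2 * M * th.
  apply: (le_trans dya); rewrite ler_pM2r//.
  by move: ub1 ub2; rewrite !ler_norml => /andP[? ?] /andP[? ?]; lra.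
have Lyz : dotv p y - dotv p z' <= N * (`|y - z| + th * (2 * D)).
  rewrite -dotvBr; apply: (le_trans (ler_norm _)).
  apply: (le_trans (dotv_norm_le _ _)); rewrite -/N ler_wpM2l//.
  rewrite /z' opprD addrA (le_trans (ler_normB _ _))// lerD2l normrZ gtr0_norm//.
  rewrite ler_wpM2l ?(ltW th0)// (le_trans (ler_normB _ _))//.
  rewrite mulr_natl mulr2n lerD ?(OD x0)//.
  exact: (closure_bounded OD).
have mE' : 2 * M * th + N * (2 * D) * th <= e / 4 by rewrite -mulrDl.
have yN' : N * `|y - z| <= e / 4.
  by have := normr_ge0 (y - z); move: yN; rewrite mulrDr mulr1 mulrC; lra.
move: uy inc Lyz Lz; rewrite ler_norml => /andP[+ _].
move: (u h _) (u h _) (ulimit _) (dotv p y) (dotv p z') (`|y - z|) yN'.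
move=> a c v q q' Y yN'.
rewrite mulrDr; lra.
Qed.

Lemma affine_le_mesh p b e :
  (forall y, Omega y -> dotv p y + b <= ulimit y) -> 0 < e ->
  \forall h \near U, forall y, mesh Omega h y -> dotv p y + b - e <= u h y.
Proof.
move=> Lv e0; have [D D0 OD] := bounded_setP Omega_bounded.
have clc : compact (closure Omega).
  apply: bounded_closed_compact; last exact: closed_closure.
  exists D; split; first exact: num_real.
  by move=> x Dx y /(closure_bounded OD)/le_trans; apply; exact: ltW.
have : \forall h \near U, forall y, closure Omega y ->
    mesh_int Omega h y -> dotv p y + b - e <= u h y.
  apply: near_forall_compact => // z clz.
  have [s s0 us] := affine_le_mesh_int_near Lv e0 clz.
  by exists s => //; apply: filterS us => h us y _ ys yO; exact: us.
apply: filterS2 (near_small h0_gt0) => h hh uh y [yO|yb].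
  by apply: uh => //; apply: subset_closure; case: yO.
rewrite (u_boundary hh yb); have [yb' _] := yb.
by have := affine_le_boundary yb' Lv; lra.
Qed.

(** The competitors in the convex envelope are affine minorants of the limit that
    are almost exact at [x], lowered slightly to be minorants of [u h]. *)
Lemma convex_envelope_near_ge x e : Omega x -> 0 < e ->
  exists2 s, 0 < s & \forall h \near U, forall y, `|y - x| < s ->
    ((ulimit x - e)%:E <= convex_envelope Omega h (u h) y)%E.
Proof.
move=> Ox e0; have e40 : 0 < e / 4 by rewrite divr_gt0.
have [|p [b [Lv Lx]]] := affine_minorant Omega_convex ulimit_convex Ox _ e40.
  move=> e' e'0; have e'20 : 0 < e' / 2 by rewrite divr_gt0.
  have [r r0 rv] := ulimit_continuous Ox e'20.
  by exists r => // y Oy /(rv _ Oy); rewrite ler_norml => /andP[+ _]; lra.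
pose N := d%:R * `|p|; have N0 : 0 <= N by rewrite mulr_ge0.
have N1 : 0 < N + 1 by rewrite ltr_pwDr.
exists (e / 4 / (N + 1)); first by rewrite divr_gt0.
apply: filterS (affine_le_mesh Lv e40) => h Lu y.
rewrite ltr_pdivlMr// mulrDr mulr1 => yx.
apply: (@le_trans _ _ (dotv p y + (b - e / 4))%:E).
  rewrite lee_fin; have := dotv_norm_le p (y - x).
  rewrite dotvBr -/N ler_norml => /andP[+ _].
  have := normr_ge0 (y - x); move: yx; rewrite mulrC; lra.
apply: ereal_sup_ubound; exists (p, b - e / 4) => //= z zO.
by rewrite addrA; exact: Lu.
Qed.

Lemma convex_envelope_near x e : Omega x -> 0 < e ->
  exists2 s, 0 < s & \forall h \near U, forall y, Omega y -> `|y - x| < s ->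
    (`|convex_envelope Omega h (u h) y - (ulimit y)%:E| <= e%:E)%E.
Proof.
move=> Ox e0; have e20 : 0 < e / 2 by rewrite divr_gt0.
have [s1 s10 le1] := convex_envelope_near_le Ox e20.
have [s2 s20 ge1] := convex_envelope_near_ge Ox e20.
have [s3 s30 v3] := ulimit_continuous Ox e20.
exists (Num.min s1 (Num.min s2 s3)); first by rewrite !lt_min s10 s20.
apply: filterS2 le1 ge1 => h le1 ge1 y Oy; rewrite !lt_min => /and3P[y1 y2 y3].
have := le1 y y1; have := ge1 y y2; have := v3 _ Oy y3.
case: (convex_envelope _ _ _ _) => [r| |]//=.
by rewrite !lee_fin !ler_norml => /andP[? ?] ? ?; apply/andP; split; lra.
Qed.

End Boundary.

End Limit.

(** * Exhaustion by compact sets and conclusion *)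

Section InnerSets.
Context {R : realType} {d : nat} (Omega : set 'rV[R]_d).
Context (Omega_open : open Omega) (Omega_bounded : bounded_set Omega).

Definition inner_set (k : nat) : set 'rV[R]_d :=
  [set x | forall y, ~ Omega y -> k.+1%:R^-1 <= `|x - y|].

Lemma inner_set_sub k : inner_set k `<=` Omega.
Proof.
move=> x Kx; apply: contrapT => /Kx; rewrite subrr normr0 leNgt.
by rewrite invr_gt0 ltr0n.
Qed.

Lemma inner_set_compact k : compact (inner_set k).
Proof.
apply: bounded_closed_compact.
  have [D [Dr OD]] := Omega_bounded; exists D; split => // x Dx y /inner_set_sub.
  exact: OD.
move=> x /closure_normP clx y nOy; apply/ler_addgt0Pr => e e0.
have [z Kz zx] := clx e e0; apply: (le_trans (Kz y nOy)).
by rewrite (le_trans (ler_distD x _ _))// addrC lerD2l ltW.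
Qed.

Lemma near_inner_set (K : set 'rV[R]_d) : compact K -> K `<=` Omega ->
  \forall k \near \oo, K `<=` inner_set k.
Proof.
move=> /compact_near_coveringP Kc KO; apply: Kc => x /KO Ox.
have [e e0 eO] := open_normP Omega_open Ox; have e20 : 0 < e / 2 by rewrite divr_gt0.
exists (ball x (e / 2), [set k | k.+1%:R^-1 < e / 2]) => /=.
  by split; [exact: nbhsx_ballx|exact: near_infty_natSinv_lt (PosNum e20)].
move=> [x' k] /= [xx' ke] y nOy; rewrite leNgt; apply/negP => x'y; apply: nOy.
apply: eO; move: xx'; rewrite -ball_normE/= => xx'.
rewrite (le_lt_trans (ler_distD x' _ _))// [ltRHS]splitr ltrD//.
  by rewrite distrC (lt_trans x'y).
by rewrite distrC.
Qed.

End InnerSets.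

Theorem theorem14 (R : realType) (d : nat) (hd : (0 < d)%N)
  (Omega : set 'rV[R]_d)
  (Omega_open : open Omega) (Omega_nonempty : Omega !=set0)
  (Omega_bounded : bounded_set Omega) (Omega_convex : convex_set Omega)
  (h0 : R) (h0_gt0 : 0 < h0)
  (mesh_nonempty : forall h, 0 < h < h0 -> mesh_int Omega h !=set0)
  (u : R -> 'rV[R]_d -> R)
  (u_convex : forall h, 0 < h < h0 -> discrete_convex Omega h (u h))
  (M : R)
  (u_bounded : forall h, 0 < h < h0 ->
     forall x, mesh Omega h x -> `|u h x| <= M)
  (C : R)
  (mass_bounded : forall h, 0 < h < h0 ->
     (monge_ampere_mass Omega h (u h) <= C%:E)%E)
  (g : 'rV[R]_d -> R)
  (g_convex : convex_function (closure Omega) g)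
  (g_continuous : {within closure Omega, continuous g})
  (u_boundary : forall h, 0 < h < h0 ->
     forall x, mesh_bdry Omega h x -> u h x = g x) :
  exists (hk : nat -> R) (v : 'rV[R]_d -> R),
    [/\ forall k, 0 < hk k < h0,
        hk k @[k --> \oo] --> (0 : R) &
        [/\ convex_function Omega v,
            {within Omega, continuous v},
            cvg_on_compacts Omega (fun=> setT)
              (fun k => convex_envelope Omega (hk k) (u (hk k))) v,
            cvg_on_compacts Omega (fun k => mesh_int Omega (hk k))
              (fun k x => (u (hk k) x)%:E) v &
            forall zeta, bdry Omega zeta ->
              v x @[x --> within Omega (nbhs zeta)] --> g zeta]].
Proof.
have [U [U_ultra U0]] := ultraFilterLemma (at_right_proper_filter (0 : R)).
pose v := ulimit u U.
have upper := discrete_convex_boundary_upper Omega_open Omega_nonempty Omega_bounded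
  Omega_convex h0_gt0 u_convex u_bounded g_continuous u_boundary.
have lower := discrete_mass_boundary_lower Omega_open Omega_nonempty Omega_bounded
  Omega_convex g_continuous u_boundary mass_bounded g_convex.
have vcont := ulimit_continuous Omega_open Omega_convex h0_gt0 u_convex u_bounded
  U_ultra U0.
have uv := ulimit_near_diag Omega_open Omega_convex h0_gt0 u_convex u_bounded
  U_ultra U0.
have Gv := convex_envelope_near Omega_open Omega_nonempty Omega_bounded
  Omega_convex h0_gt0 u_convex u_bounded U_ultra U0 u_boundary upper.
(* a single step size that is good on the [k]-th compact set of the exhaustion *)
have /choice[hk hkP] k : exists h, [/\ 0 < h < h0, h < k.+1%:R^-1,
    forall x, inner_set Omega k x ->
      (`|convex_envelope Omega h (u h) x - (v x)%:E| <= (k.+1%:R^-1)%:E)%E &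
    forall x, inner_set Omega k x -> mesh_int Omega h x ->
      `|u h x - v x| <= k.+1%:R^-1].
  have k0 : 0 < k.+1%:R^-1 :> R by rewrite invr_gt0 ltr0n.
  have Kc : compact (inner_set Omega k) by exact: inner_set_compact.
  have t0 : 0 < Num.min h0 k.+1%:R^-1 by rewrite lt_min h0_gt0.
  have ev1 : \forall h \near U, forall x, inner_set Omega k x ->
      (`|convex_envelope Omega h (u h) x - (v x)%:E| <= (k.+1%:R^-1)%:E)%E.
    apply: near_forall_compact => // x /inner_set_sub Ox.
    have [s s0 us] := Gv x _ Ox k0; exists s => //.
    by apply: filterS us => h us y /inner_set_sub; exact: us.
  have ev2 : \forall h \near U, forall x, inner_set Omega k x -> mesh_int Omega h x ->
      `|u h x - v x| <= k.+1%:R^-1.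
    apply: near_forall_compact => // x /inner_set_sub Ox.
    have [s s0 us] := uv x _ Ox k0; exists s => //.
    by apply: filterS us => h us y _ ys yO; exact: us.
  have [h [[hs h1] h2]] := @filter_ex _ U _ _
    (filterI (filterI (near_small U0 t0) ev1) ev2).
  by exists h; move: hs; rewrite lt_min => /and3P[? ? ?]; split => //; apply/andP.
have hk0 k : 0 < hk k < h0 by have [] := hkP k.
exists hk, v; split => //.
  apply/cvgrPdist_lt => e e0.
  apply: filterS (near_infty_natSinv_lt (PosNum e0)) => k /= ke.
  have [/andP[hk1 _] hk2 _ _] := hkP k.
  by rewrite sub0r normrN gtr0_norm// (lt_trans hk2).
split.
- exact: (ulimit_convex Omega_open Omega_convex h0_gt0 u_convex u_bounded U_ultra U0).
- rewrite continuous_open_subspace// => x; rewrite inE => Ox.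
  apply/(@cvgrPdist_le _ _ _ (nbhs x) (nbhs_filter x) v (v x)) => e e0.
  have [s s0 vs] := vcont x e Ox e0.
  apply: filterS2 (nbhsx_ballx x s s0) (open_nbhs_nbhs (conj Omega_open Ox)) => y.
  by rewrite -ball_normE/= distrC => yx Oy; rewrite distrC vs.
- move=> K Kc KO e e0; have := near_inner_set Omega_open Kc KO.
  apply: filterS2 (near_infty_natSinv_lt (PosNum e0)) => k /= ke KK x Kx _.
  have [_ _ + _] := hkP k; move=> /(_ x (KK x Kx))/le_trans; apply.
  by rewrite lee_fin ltW.
- move=> K Kc KO e e0; have := near_inner_set Omega_open Kc KO.
  apply: filterS2 (near_infty_natSinv_lt (PosNum e0)) => k /= ke KK x Kx xO.
  have [_ _ _ +] := hkP k; move=> /(_ x (KK x Kx) xO)/le_trans -/(_ _ (ltW ke)).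
  by [].
move=> zeta zb; apply/cvgrPdist_le => e e0.
have [s s0 vs] := ulimit_boundary_upper Omega_open h0_gt0 u_bounded U_ultra U0
  upper zb e0.
have [s' s'0 us'] := lower _ _ zb e0.
have s''0 : 0 < Num.min s' h0 by rewrite lt_min s'0.
have t0 : 0 < Num.min s (Num.min s' h0 / 2) by rewrite lt_min s0 divr_gt0.
rewrite near_withinE; apply: filterS (nbhsx_ballx zeta _ t0) => x.
rewrite -ball_normE/= distrC lt_min => /andP[xs xs'] Ox.
have vlow : g zeta - e <= v x.
  apply: (ulimit_closed Omega_open h0_gt0 u_bounded U_ultra U0
    (@closed_ge _ (g zeta - e)) s''0 _ Ox xs') => h /andP[hgt0 +] y yO.
  rewrite !lt_min => /andP[_ hh0] /andP[ys' _].
  by apply: us' => //; rewrite hgt0.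
by have := vs x Ox xs; rewrite ler_distlC; rewrite -/v; lra.
Qed.
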